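(* For $d\in\mathbb{N}$, the map $$\Phi:\mathrm{Mult}(\mathcal{H}_d)\to\mathrm{Mult}(H^2_d),\quad\varphi\mapsto\varphi\circ\tau,$$ is a unital complete isometry.
   Context: $\mathbb{B}_d$ is the open Euclidean unit ball in $\mathbb{C}^d$, $\mathbb{D}$ the open unit disc. $H^2_d$ is the Drury--Arveson space, i.e. the reproducing kernel Hilbert space on $\mathbb{B}_d$ with kernel $\frac{1}{1-\langle z,w\rangle}$. The map $\tau:\overline{\mathbb{B}_d}\to\overline{\mathbb{D}}$ is $\tau(z)=d^{d/2}z_1z_2\cdots z_d$; it maps $\mathbb{B}_d$ onto $\mathbb{D}$. Let $a_n=\|\tau^n\|_{H^2_d}^{-2}$ for $n\in\mathbb{N}_0$, and let $\mathcal{H}_d$ be the reproducing kernel Hilbert space on $\mathbb{D}$ with kernel $K(z,w)=\sum_{n=0}^\infty a_n(z\overline{w})^n$. For a reproducing kernel Hilbert space $\mathcal{H}$, $\mathrm{Mult}(\mathcal{H})$ is the algebra of functions $\varphi$ with $\varphi\mathcal{H}\subset\mathcal{H}$, regarded as an operator algebra in $\mathcal{B}(\mathcal{H})$ via $\varphi\mapsto M_\varphi$ ($M_\varphi f=\varphi f$), with $r\times r$ matrices over $\mathrm{Mult}(\mathcal{H})$ normed as operators on $\mathcal{H}^r$. A linear map is a complete isometry if its entrywise application to $r\times r$ matrices is isometric for every $r\in\mathbb{N}$. *)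

(* Defs.v *)
From HB Require Import structures.
From mathcomp Require Import all_boot all_order all_algebra.
From mathcomp Require Export complex.
From mathcomp Require Import all_classical all_reals all_analysis.

Set Implicit Arguments.
Unset Strict Implicit.
Unset Printing Implicit Defensive.

Import Order.TTheory GRing.Theory Num.Theory numFieldNormedType.Exports.

Local Open Scope classical_set_scope.
Local Open Scope ring_scope.

(** A reproducing kernel Hilbert space on [X] with kernel [K]: a set of
    functions together with an inner product, linear in its first argument.
    [rk_dot] is a total function, but it is only constrained, and only used, on
    the functions of the space.  By the Moore-Aronszajn theorem such a space
    exists for every positive semi-definite [K], and its underlying set and its
    inner product are determined by [K]; "the" space with kernel [K] is thus
    rendered as an arbitrary inhabitant of [rkhs K]. *)
Record rkhs (R : realType) (X : Type) (K : X -> X -> R[i]) := RKHS {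
  rk_set : set (X -> R[i]);
  rk_dot : (X -> R[i]) -> (X -> R[i]) -> R[i];
  rk_set0 : rk_set (fun=> 0);
  rk_setP : forall (a : R[i]) (f g : X -> R[i]),
    rk_set f -> rk_set g -> rk_set (fun x => a * f x + g x);
  rk_dotP : forall (a : R[i]) (f g h : X -> R[i]),
    rk_set f -> rk_set g -> rk_set h ->
    rk_dot (fun x => a * f x + g x) h = a * rk_dot f h + rk_dot g h;
  rk_dotC : forall f g : X -> R[i],
    rk_set f -> rk_set g -> rk_dot g f = (rk_dot f g)^*;
  rk_dot_ge0 : forall f : X -> R[i], rk_set f -> 0 <= rk_dot f f;
  rk_dot_eq0 : forall f : X -> R[i], rk_set f -> rk_dot f f = 0 -> f = fun=> 0;
  rk_complete : forall u : nat -> X -> R[i],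
    (forall n, rk_set (u n)) ->
    (forall e : R, 0 < e -> \forall m & n \near \oo,
      Num.sqrt (complex.Re (rk_dot (u m \- u n) (u m \- u n))) < e) ->
    exists2 f : X -> R[i], rk_set f &
      Num.sqrt (complex.Re (rk_dot (u n \- f) (u n \- f))) @[n --> \oo]
        --> (0 : R);
  rk_kernel : forall w : X, rk_set (K^~ w);
  rk_reproducing : forall (f : X -> R[i]) (w : X),
    rk_set f -> rk_dot f (K^~ w) = f w }.

Section Multipliers.
Variables (R : realType) (X : Type) (K : X -> X -> R[i]) (H : rkhs K).

Definition hnorm (f : X -> R[i]) : R := Num.sqrt (complex.Re (rk_dot H f f)).

Definition Mult : set (X -> R[i]) :=
  [set phi | forall f, rk_set H f -> rk_set H (phi \* f)].

(** Elements of [H^r], as families ['I_r -> X -> R[i]]. *)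
Definition hpow (r : nat) : set ('I_r -> X -> R[i]) :=
  [set f | forall i, rk_set H (f i)].

Definition hpow_norm (r : nat) (f : 'I_r -> X -> R[i]) : R :=
  Num.sqrt (\sum_i hnorm (f i) ^+ 2).

Definition mx_apply (r : nat) (F : 'M[X -> R[i]]_r) (f : 'I_r -> X -> R[i]) :
    'I_r -> X -> R[i] :=
  fun i x => \sum_j F i j x * f j x.

(** The operator norm on [H^r].  It is taken in [\bar R] so that the definition
    does not presuppose that multiplication operators are bounded. *)
Definition mult_norm (r : nat) (F : 'M[X -> R[i]]_r) : \bar R :=
  ereal_sup [set (hpow_norm (mx_apply F f))%:E |
             f in [set f | @hpow r f /\ hpow_norm f <= 1]].

End Multipliers.

Section MultiplierMaps.
Variables (R : realType) (X Y : Type).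
Variables (K : X -> X -> R[i]) (L : Y -> Y -> R[i]).
Variables (H : rkhs K) (G : rkhs L) (Psi : (X -> R[i]) -> (Y -> R[i])).

Definition mult_linear : Prop :=
  forall (a : R[i]) (phi psi : X -> R[i]), Mult H phi -> Mult H psi ->
    Psi (fun x => a * phi x + psi x) = fun y => a * Psi phi y + Psi psi y.

Definition mult_unital : Prop := Psi (fun=> 1) = fun=> 1.

Definition complete_isometry : Prop :=
  mult_linear /\
  forall (r : nat) (F : 'M[X -> R[i]]_r), (forall i j, Mult H (F i j)) ->
    mult_norm G (map_mx Psi F) = mult_norm H F.

End MultiplierMaps.

Definition unit_ball (R : realType) (d : nat) : Type :=
  {z : 'rV[R[i]]_d | \sum_i `|z 0 i| ^+ 2 < 1}.

Definition unit_disc (R : realType) : Type := {z : R[i] | `|z| < 1}.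

Definition DA_kernel (R : realType) (d : nat) (z w : unit_ball R d) : R[i] :=
  (1 - \sum_i val z 0 i * (val w 0 i)^*)^-1.

Definition tau (R : realType) (d : nat) (z : 'rV[R[i]]_d) : R[i] :=
  ((d%:R : R) `^ (d%:R / 2))%:C%C * \prod_i z 0 i.

Lemma tau_lt1 (R : realType) (d : nat) (hd : (0 < d)%N) (z : unit_ball R d) :
  `|tau (val z)| < 1.
Proof.
case: z => z /= hz.
rewrite -(@expr_lt1 _ 2) // /tau normrM exprMn normr_prod -prodrXl.
have -> : `|((d%:R : R) `^ (d%:R / 2))%:C%C| ^+ 2 = d%:R ^+ d :> R[i].
  rewrite ger0_norm ?lecR ?powR_ge0 // -rmorphXn /=.
  rewrite -powR_mulrn ?powR_ge0 // -powRrM divfK ?pnatr_eq0 //.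
  by rewrite powR_mulrn ?ler0n // rmorphXn rmorph_nat.
have [+ _] := @leif_AGM R[i] _ predT (fun i : 'I_d => `|z 0 i| ^+ 2)
  (fun i _ => exprn_ge0 2 (normr_ge0 (z 0 i))).
rewrite card_ord => hle.
have d0 : 0 < d%:R :> R[i] by rewrite ltr0n.
apply: (@le_lt_trans _ _ ((\sum_i `|z 0 i| ^+ 2) ^+ d)).
  apply: (le_trans (ler_wpM2l (exprn_ge0 _ (ltW d0)) hle)).
  by rewrite -exprMn mulrC divfK // gt_eqF.
by rewrite expr_lt1 // sumr_ge0 // => i _; rewrite exprn_ge0.
Qed.

(** [tau] as a map from the open ball to the open disc. *)
Definition tau_ball (R : realType) (d : nat) (hd : (0 < d)%N) (z : unit_ball R d) :
    unit_disc R :=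
  exist _ (tau (val z)) (tau_lt1 hd z).

Section SymmetricSpace.
Variables (R : realType) (d : nat) (H2d : rkhs (@DA_kernel R d)).

Definition tau_coef (n : nat) : R :=
  hnorm H2d (fun z : unit_ball R d => tau (val z) ^+ n) ^- 2.

Definition tau_kernel (z w : unit_disc R) : R[i] :=
  limn (series (fun n : nat =>
    (tau_coef n)%:C%C * (val z * (val w)^*) ^+ n) : nat -> R[i]^o).

End SymmetricSpace.

Definition tau_pullback (R : realType) (d : nat) (hd : (0 < d)%N)
    (phi : unit_disc R -> R[i]) : unit_ball R d -> R[i] :=
  phi \o tau_ball hd.

(* Main.v *)
Require Import Defs.
From HB Require Import structures.
From mathcomp Require Import all_boot all_order all_algebra.
From mathcomp Require Import all_classical all_reals all_analysis.
From mathcomp Require Import zify ring lra.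

Set Implicit Arguments.
Unset Strict Implicit.
Unset Printing Implicit Defensive.

Import Order.TTheory GRing.Theory Num.Theory numFieldNormedType.Exports.

Local Open Scope classical_set_scope.
Local Open Scope ring_scope.

(** Write [DA] for the Drury-Arveson kernel, [K] for the kernel of the space on
    the disc, and [A z w := K (tau z) (tau w)] for the pullback of [K] to the
    ball.  Everything is expressed through positive semi-definite kernels, and
    two facts about [A] carry the proof.

    The first is an isometric embedding.  Expand [DA z w] as a sum of
    [mono u z * (mono u w)^*] over all words [u] in the alphabet ['I_d], where
    [mono u] is the monomial spelled by [u].  Monomials with different contents
    are orthogonal, because rotating one coordinate is a symmetry of [DA]
    ([mono_orthogonal]).  The balanced words, those using every letter equally
    often, spell the powers of the product of the coordinates, hence multiples
    of the powers of [tau]; counting them gives the norms of these powers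
    ([mono_hnorm]), and [A] turns out to be the part of [DA] carried by the
    balanced words ([tau_kernel_pull]).  So [DA - A] is positive, which makes
    composition with [tau] a contraction, and orthogonality makes it isometric on
    combinations of kernel functions, hence everywhere ([pullback_isometry]).
    This bounds the multiplier norm on the disc by the one on the ball.

    The second is a factorization.  Every word is, in exactly one way, a balanced
    word followed by a word without nonempty balanced prefix: cut after the
    longest balanced prefix.  Since words contribute multiplicatively,
    [DA = A * C] where [C] is again a sum of terms [mono u z * (mono u w)^*], over
    the words without nonempty balanced prefix ([DA_factor]).  A matrix [F] of
    multipliers has norm at most [M] exactly when the kernel
    [(M ^ 2 - F F^* ) * K] is positive ([psd_mult_defect], [mult_defect_psd]).
    Pulling this kernel back along [tau] and multiplying it with the positive
    kernel [C] preserves positivity and replaces [K] by [DA]; the same bound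
    therefore holds on the ball ([bound_transfer]).

    To go from positivity of kernels back to functions of the space one needs
    the converse of the reproducing property: a function [f] for which
    [c ^ 2 * K - f f^*] is positive belongs to the space with norm at most [c]
    ([rk_membership]), a form of the Riesz representation theorem.  A single
    multiplier of the disc space transfers once it is known to be bounded, which
    is a case of the uniform boundedness principle ([mult_bounded]). *)

(** * Absolute values and limits of complex sequences *)
Section ComplexPreliminaries.
Variable R : realType.
Implicit Types (a b q t z : R[i]) (u v : nat -> R[i]).

(** The norm of [R[i]] takes its values in [R[i]]; this is the same number in
    [R], where the linear arithmetic and the limit theorems apply. *)
Definition cabs z : R := complex.Re `|z|.

Lemma normr_cabs z : `|z| = (cabs z)%:C%C.
Proof. by rewrite /cabs RRe_real // normr_real. Qed.

Lemma cabs_ge0 z : 0 <= cabs z.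
Proof. by rewrite -lecR -normr_cabs normr_ge0. Qed.

Lemma cabsM z t : cabs (z * t) = cabs z * cabs t.
Proof. by apply: complexI; rewrite rmorphM /= -!normr_cabs normrM. Qed.

Lemma cabsD z t : cabs (z + t) <= cabs z + cabs t.
Proof. by rewrite -lecR rmorphD /= -!normr_cabs ler_normD. Qed.

Lemma cabsJ z : cabs z^* = cabs z.
Proof. by rewrite /cabs norm_conjC. Qed.

Lemma cabsN z : cabs (- z) = cabs z.
Proof. by rewrite /cabs normrN. Qed.

Lemma cabs0 : cabs 0 = 0.
Proof. by rewrite /cabs normr0. Qed.

Lemma cabs_eq0 z : cabs z = 0 -> z = 0.
Proof. by move=> z0; apply/normr0_eq0; rewrite normr_cabs z0. Qed.

Lemma cabs_real (x : R) : cabs x%:C%C = `|x|.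
Proof. by rewrite /cabs normc_def /= expr0n /= addr0 sqrtr_sqr. Qed.

Lemma cabs1 : cabs 1 = 1.
Proof. by rewrite /cabs normr1. Qed.

Lemma cabs_sqr z : (cabs z ^+ 2)%:C%C = z * z^*.
Proof. by rewrite rmorphXn /= -normr_cabs normCK. Qed.

Lemma Re_le_cabs z : `|complex.Re z| <= cabs z.
Proof. by rewrite -lecR -normr_cabs normc_ge_Re. Qed.

Lemma ReIm_sqr z : cabs z ^+ 2 = complex.Re z ^+ 2 + complex.Im z ^+ 2.
Proof. by apply: complexI; rewrite cabs_sqr -normCK -add_Re2_Im2. Qed.

Lemma cabs_le_ReIm z : cabs z <= `|complex.Re z| + `|complex.Im z|.
Proof.
rewrite -(@ler_pXn2r _ 2) ?nnegrE ?cabs_ge0 ?addr_ge0 // ReIm_sqr.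
rewrite sqrrD !real_normK ?num_real //.
have : 0 <= `|complex.Re z| * `|complex.Im z| by rewrite mulr_ge0.
by rewrite mulr2n; nra.
Qed.

Lemma Im_le_cabs z : `|complex.Im z| <= cabs z.
Proof.
rewrite -(@ler_pXn2r _ 2) ?nnegrE ?cabs_ge0 // ReIm_sqr.
by rewrite real_normK ?num_real // lerDr sqr_ge0.
Qed.

Lemma conj_realC (x : R) : (x%:C%C)^* = x%:C%C.
Proof. by apply/CrealP; apply/complex_realP; exists x. Qed.

Lemma addrJ z : z + z^* = (complex.Re z *+ 2)%:C%C.
Proof. by case: z => x y; apply/eqP; rewrite eq_complex /= addrN !eqxx. Qed.

Lemma cRe_conj z : complex.Re z^* = complex.Re z.
Proof. by case: z. Qed.

Lemma cRe_add z t : complex.Re (z + t) = complex.Re z + complex.Re t.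
Proof. by case: z; case: t. Qed.

Lemma cIm_add z t : complex.Im (z + t) = complex.Im z + complex.Im t.
Proof. by case: z; case: t. Qed.

Lemma cRe_mul z t :
  complex.Re (z * t) = complex.Re z * complex.Re t - complex.Im z * complex.Im t.
Proof. by case: z; case: t. Qed.

Lemma cIm_mul z t :
  complex.Im (z * t) = complex.Re z * complex.Im t + complex.Im z * complex.Re t.
Proof. by case: z; case: t. Qed.

(** The discriminant argument behind the Cauchy-Schwarz inequalities, both for
    inner products and for kernels; the case [a = 0] is where the form is
    degenerate, and there [b] vanishes. *)
Lemma quad_disc a b q : 0 <= a ->
  (forall t, 0 <= t * t^* * a + t * b + (t * b)^* + q) -> b * b^* <= a * q.
Proof.
move=> a0 h.
have q0 : 0 <= q.
  by have := h 0; rewrite !mul0r conjC0 !add0r.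
have aJ : a^* = a by apply/CrealP; apply: ger0_real.
have qJ : q^* = q by apply/CrealP; apply: ger0_real.
have [a_eq0|a_neq0] := eqVneq a 0.
  have [->|b0] := eqVneq b 0; first by rewrite mul0r mulr_ge0.
  (* for this value of t the affine form in t takes the value - (q + 2) *)
  have := h (- (q + 1) / b).
  rewrite a_eq0 mulr0 add0r divfK // rmorphN rmorphD /= qJ rmorph1.
  have -> : - (q + 1) + - (q + 1) + q = - (q + 2) by ring.
  rewrite oppr_ge0 => hq.
  have : 0 < q + 2 by rewrite ltr_wpDl // ltr0n.
  by move=> /lt_le_trans /(_ hq); rewrite ltxx.
(* the minimizer of the quadratic form *)
have := h (- b^* / a).
rewrite !rmorphM /= !rmorphN /= conjCK !fmorphV /= aJ => {}h.
have : 0 <= a * (q - b * b^* / a).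
  rewrite mulr_ge0 //; apply: le_trans h _; rewrite le_eqVlt; apply/orP; left.
  by apply/eqP; field.
by rewrite mulrBr mulrCA divff // mulr1 subr_ge0.
Qed.

(** Componentwise convergence gives the algebra of limits and closedness of the
    nonnegative numbers directly from the real case.  The link with the norm
    topology is [cvgC_lim]. *)
Definition cvgC u z : Prop :=
  (fun n => complex.Re (u n)) @ \oo --> complex.Re z /\
  (fun n => complex.Im (u n)) @ \oo --> complex.Im z.

Lemma cvgC_cst z : cvgC (fun=> z) z.
Proof. by split; exact: cvg_cst. Qed.

Lemma cvgCD u v a b : cvgC u a -> cvgC v b -> cvgC (fun n => u n + v n) (a + b).
Proof.
case=> ua1 ua2 [vb1 vb2]; split.
  by rewrite cRe_add; under eq_fun do rewrite cRe_add; exact: cvgD.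
by rewrite cIm_add; under eq_fun do rewrite cIm_add; exact: cvgD.
Qed.

Lemma cvgCM u v a b : cvgC u a -> cvgC v b -> cvgC (fun n => u n * v n) (a * b).
Proof.
case=> ua1 ua2 [vb1 vb2]; split.
  by rewrite cRe_mul; under eq_fun do rewrite cRe_mul; apply: cvgB; apply: cvgM.
by rewrite cIm_mul; under eq_fun do rewrite cIm_mul; apply: cvgD; apply: cvgM.
Qed.

Lemma cvgCZ u a b : cvgC u a -> cvgC (fun n => b * u n) (b * a).
Proof. by move=> ua; apply: cvgCM ua; exact: cvgC_cst. Qed.

Lemma cvgCB u v a b : cvgC u a -> cvgC v b -> cvgC (fun n => u n - v n) (a - b).
Proof.
move=> ua vb; rewrite -mulN1r; under eq_fun do rewrite -(mulN1r (v _)).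
by apply: cvgCD => //; exact: cvgCZ.
Qed.

Lemma cvgn_sum (I : Type) (s : seq I) (F : I -> nat -> R) (l : I -> R) :
  (forall i, F i n @[n --> \oo] --> l i) ->
  \sum_(i <- s) F i n @[n --> \oo] --> \sum_(i <- s) l i.
Proof.
move=> Fl; elim: s => [|i s ih].
  by rewrite big_nil; under eq_fun do rewrite big_nil; exact: cvg_cst.
by rewrite big_cons; under eq_fun do rewrite big_cons; exact: cvgD.
Qed.

Lemma cvgC_sum (I : Type) (s : seq I) (F : I -> nat -> R[i]) (l : I -> R[i]) :
  (forall i, cvgC (F i) (l i)) ->
  cvgC (fun n => \sum_(i <- s) F i n) (\sum_(i <- s) l i).
Proof.
move=> Fl; elim: s => [|i s ih].
  by rewrite big_nil; under eq_fun do rewrite big_nil; exact: cvgC_cst.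
by rewrite big_cons; under eq_fun do rewrite big_cons; exact: cvgCD.
Qed.

Lemma cvgC_unique u a b : cvgC u a -> cvgC u b -> a = b.
Proof.
case=> ua1 ua2 [ub1 ub2]; apply/eqP; rewrite eq_complex.
by apply/andP; split; apply/eqP; [apply: cvg_unique ua1 ub1|apply: cvg_unique ua2 ub2];
  exact: norm_hausdorff.
Qed.

Lemma cvgC_ge0 u a : cvgC u a -> (forall n, 0 <= u n) -> 0 <= a.
Proof.
case=> ua1 ua2 u0; rewrite lecE /=; apply/andP; split; last first.
  apply: (cvgr_to_ge ua1); apply: nearW => n.
  by have := u0 n; rewrite lecE => /andP[].
apply/eqP; apply: cvg_unique ua2 _; first exact: norm_hausdorff.
rewrite (_ : (fun n => _) = fun=> 0); first exact: cvg_cst.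
by apply/funext => n; have := u0 n; rewrite lecE => /andP[/eqP].
Qed.

Lemma cvgC_cabs u z : cvgC u z <-> (fun n => cabs (u n - z)) @ \oo --> (0 : R).
Proof.
split=> [[u1 u2]|uz].
  have h : (fun n => `|complex.Re (u n) - complex.Re z| +
                     `|complex.Im (u n) - complex.Im z|) @ \oo --> (0 : R).
    rewrite -(addr0 0) -{1}(normr0 R) -{1}(subrr (complex.Re z)).
    rewrite -(normr0 R) -(subrr (complex.Im z)).
    by apply: cvgD; apply: cvg_norm; apply: cvgB => //; exact: cvg_cst.
  apply: (@squeeze_cvgr _ _ _ _ (fun=> 0) _ _ _ _ _ h); last exact: cvg_cst.
  apply: nearW => n; rewrite cabs_ge0 /=; apply: le_trans (cabs_le_ReIm _) _.
  by case: (u n) => x y; case: (z).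
have aux (f : nat -> R) (l : R) : (forall n, `|f n - l| <= cabs (u n - z)) ->
    f @ \oo --> l.
  move=> hf; apply/cvgrPdist_lt => e e0.
  move/cvgr0Pnorm_lt: uz => /(_ _ e0); apply: filterS => n.
  by rewrite ger0_norm ?cabs_ge0 // distrC; exact/le_lt_trans/hf.
split; apply: aux => n.
  by apply: le_trans (Re_le_cabs _); case: (u n) => x y; case: (z).
by apply: le_trans (Im_le_cabs _); case: (u n) => x y; case: (z).
Qed.

Lemma cvgC_norm u z : cvgC u z -> (fun n => cabs (u n)) @ \oo --> cabs z.
Proof.
move=> /cvgC_cabs uz; apply/cvgrPdist_lt => e e0.
move/cvgr0Pnorm_lt: uz => /(_ _ e0); apply: filterS => n.
rewrite ger0_norm ?cabs_ge0 //; apply: le_lt_trans.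
have h1 := cabsD (u n - z) z; rewrite subrK in h1.
have h2 := cabsD (z - u n) (u n); rewrite subrK in h2.
rewrite -opprB cabsN in h2.
by rewrite ler_norml; apply/andP; split; lra.
Qed.

Lemma cvgC_squeeze u z (e : nat -> R) : (forall n, cabs (u n - z) <= e n) ->
  e @ \oo --> (0 : R) -> cvgC u z.
Proof.
move=> ue e0; apply/cvgC_cabs.
apply: (@squeeze_cvgr _ _ _ _ (fun=> 0) _ _ _ _ _ e0); last exact: cvg_cst.
by apply: nearW => n; rewrite cabs_ge0 ue.
Qed.

Lemma cvgC_subseq u z (phi : nat -> nat) : (forall n, (n <= phi n)%N) ->
  cvgC u z -> cvgC (u \o phi) z.
Proof.
move=> phin.
have phioo : phi @ \oo --> \oo.
  move=> A [N _ NA]; exists N => // n /= Nn; apply: NA => /=.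
  exact: leq_trans Nn (phin n).
case=> u1 u2; split.
  exact: (@cvg_comp _ _ _ phi (fun n => complex.Re (u n)) _ _ _ phioo u1).
exact: (@cvg_comp _ _ _ phi (fun n => complex.Im (u n)) _ _ _ phioo u2).
Qed.

Lemma cvgC_near u v z : (exists N, forall n, (N <= n)%N -> u n = v n) ->
  cvgC u z -> cvgC v z.
Proof.
move=> [N uv] [u1 u2]; split.
  apply: cvg_trans u1; apply: near_eq_cvg.
  by exists N => // n /= Nn; rewrite uv.
apply: cvg_trans u2; apply: near_eq_cvg.
by exists N => // n /= Nn; rewrite uv.
Qed.

Lemma cvgC_lim u z : cvgC u z -> limn (u : nat -> R[i]^o) = z.
Proof.
move=> /cvgC_cabs uz; apply: cvg_lim; first exact: norm_hausdorff.
apply/cvgrPdist_lt => e e0.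
have [e' ee'] : exists e' : R, e = e'%:C%C.
  by apply/complex_realP; apply: gtr0_real.
rewrite {}ee' in e0 *; rewrite ltcR in e0.
move/cvgr0Pnorm_lt: uz => /(_ _ e0); apply: filterS => n.
by rewrite ger0_norm ?cabs_ge0 // normr_cabs ltcR -opprB cabsN.
Qed.

Lemma cabs_sum (I : Type) (s : seq I) (P : pred I) (F : I -> R[i]) :
  cabs (\sum_(i <- s | P i) F i) <= \sum_(i <- s | P i) cabs (F i).
Proof.
elim/big_rec2: _ => [|i x z _ h]; first by rewrite cabs0.
by apply: le_trans (cabsD _ _) _; rewrite lerD2l.
Qed.

Lemma cvgC_geo_series (b : nat -> R[i]) (q : R) : 0 <= q < 1 ->
  (forall j, cabs (b j) <= q ^+ j) ->
  exists l, cvgC (fun n => \sum_(j < n) b j) l.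
Proof.
move=> /andP[q0 q1] bq.
have aux (f : nat -> R) : (forall j, `|f j| <= q ^+ j) ->
    (fun n => \sum_(j < n) f j) @ \oo --> limn (series f).
  move=> fq; rewrite (_ : (fun n => _) = series f); last first.
    by apply/funext => n; rewrite /series /= big_mkord.
  apply: (@normed_cvg _ R^o).
  apply: (@series_le_cvg _ _ (fun j => q ^+ j)) => [n|n|n|].
  - by rewrite /= normr_ge0.
  - by rewrite exprn_ge0.
  - exact: fq.
  rewrite (_ : (fun j => q ^+ j) = geometric 1 q).
    by apply: is_cvg_geometric_series; rewrite ger0_norm.
  by apply/funext => n; rewrite /= mul1r.
exists (Complex (limn (series (fun j => complex.Re (b j))))
                (limn (series (fun j => complex.Im (b j))))).
split=> /=.
  rewrite (_ : (fun n => _) = fun n => \sum_(j < n) complex.Re (b j)).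
    by apply: aux => j; apply: le_trans (Re_le_cabs _) _.
  by apply/funext => n; elim/big_rec2: _ => // i x y _ <-; rewrite cRe_add.
rewrite (_ : (fun n => _) = fun n => \sum_(j < n) complex.Im (b j)).
  by apply: aux => j; apply: le_trans (Im_le_cabs _) _.
by apply/funext => n; elim/big_rec2: _ => // i x y _ <-; rewrite cIm_add.
Qed.

Lemma sum_antidiagonals (V : zmodType) (F : nat -> nat -> V) n :
  \sum_(m < n) \sum_(j < m.+1) F j (m - j)%N =
  \sum_(j < n) \sum_(k < n - j) F j k.
Proof.
elim: n => [|n ih]; first by rewrite !big_ord0.
rewrite big_ord_recr /= ih [RHS]big_ord_recr /= subSnn big_ord1.
rewrite big_ord_recr /= subnn addrA -big_split /=; congr (_ + _).
by apply: eq_bigr => j _; rewrite subSn 1?ltnW // big_ord_recr.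
Qed.

(** The difference between the product of the partial sums and the partial sum
    of the product consists of terms of degree at least [n]; writing
    [q = r ^ 2], each of them is at most [r ^ n] times a term of a convergent
    geometric double series in [r]. *)
Lemma cvgC_cauchy_product (b c : nat -> R[i]) (q : R) (B G : R[i]) :
  0 <= q < 1 ->
  (forall j, cabs (b j) <= q ^+ j) -> (forall j, cabs (c j) <= q ^+ j) ->
  cvgC (fun n => \sum_(j < n) b j) B -> cvgC (fun n => \sum_(j < n) c j) G ->
  cvgC (fun n => \sum_(m < n) \sum_(j < m.+1) b j * c (m - j)%N) (B * G).
Proof.
move=> /andP[q0 q1] bq cq bB cG.
pose r := Num.sqrt q.
have r0 : 0 <= r by apply: sqrtr_ge0.
have r1 : r < 1 by rewrite -sqrtr1 ltr_sqrt.
have rq : q = r ^+ 2 by rewrite sqr_sqrtr.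
have geo n : \sum_(j < n) r ^+ j <= (1 - r)^-1.
  have h : (\sum_(j < n) r ^+ j) * (1 - r) = 1 - r ^+ n.
    rewrite -[RHS]opprB subrX1 -mulNr opprB mulrC; congr (_ * _).
  rewrite -div1r ler_pdivlMr ?subr_gt0 // h gerBl exprn_ge0 //.
have diff n : cabs (\sum_(m < n) \sum_(j < m.+1) b j * c (m - j)%N -
    (\sum_(j < n) b j) * (\sum_(j < n) c j)) <= r ^+ n * (1 - r)^-1 ^+ 2.
  rewrite (sum_antidiagonals (fun j k => b j * c k)) mulr_suml -sumrB.
  apply: le_trans (cabs_sum _ _ _) _.
  apply: (@le_trans _ _ (\sum_(j < n) r ^+ n * (r ^+ j * (1 - r)^-1))); last first.
    rewrite -mulr_sumr -mulr_suml ler_wpM2l ?exprn_ge0 // expr2.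
    by rewrite ler_wpM2r // invr_ge0 subr_ge0 ltW.
  apply: ler_sum => j _; rewrite -mulr_sumr -mulrBr -opprB mulrN cabsN.
  rewrite (big_ord_widen n c (leq_subr j n)) (bigID (fun k : 'I_n => k < n - j)%N) /=.
  rewrite addrAC subrr add0r mulr_sumr.
  apply: le_trans (cabs_sum _ _ _) _.
  apply: (@le_trans _ _ (\sum_(k < n) r ^+ n * (r ^+ j * r ^+ k))); last first.
    by rewrite -!mulr_sumr !ler_wpM2l ?exprn_ge0.
  rewrite [leRHS](bigID (fun k : 'I_n => k < n - j)%N) /= -[leLHS]add0r lerD //.
    by apply: sumr_ge0 => k _; rewrite !mulr_ge0 ?exprn_ge0.
  apply: ler_sum => k; rewrite -leqNgt leq_subLR => njk.
  rewrite cabsM; apply: (@le_trans _ _ (q ^+ j * q ^+ k)).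
    by apply: ler_pM; rewrite ?cabs_ge0.
  rewrite rq -!exprM -!exprD; apply: ler_wiXn2l => //; first exact: ltW.
  by lia.
have e0 : (fun n => r ^+ n * (1 - r)^-1 ^+ 2) @ \oo --> (0 : R).
  rewrite -(mul0r ((1 - r)^-1 ^+ 2)); apply: cvgM; last exact: cvg_cst.
  by apply: cvg_expr; rewrite ger0_norm.
have h : cvgC (fun n => \sum_(m < n) \sum_(j < m.+1) b j * c (m - j)%N -
    (\sum_(j < n) b j) * (\sum_(j < n) c j)) 0.
  by apply: cvgC_squeeze e0 => n; rewrite subr0.
have := cvgCD h (cvgCM bB cG); rewrite add0r.
by apply: cvgC_near; exists 0%N => n _; rewrite subrK.
Qed.

End ComplexPreliminaries.

(** * Positive semi-definite kernels *)
Section PositiveKernels.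
Variable R : realType.

Section Form.
Variable X : Type.
Implicit Types (K G : X -> X -> R[i]) (s : seq (R[i] * X)).

(** A finite family of points with coefficients is a list of pairs, with
    repetitions allowed: merging families is then concatenation.  The value of
    the form is the squared norm of the combination [\sum_p p.1 * K^~ p.2]. *)
Definition kform K s : R[i] :=
  \sum_(p <- s) \sum_(q <- s) p.1^* * q.1 * K p.2 q.2.

Definition psd K : Prop := forall s, 0 <= kform K s.

Lemma psd_diag K x : psd K -> 0 <= K x x.
Proof. by move=> /(_ [:: (1, x)]); rewrite /kform !big_seq1 conjC1 !mul1r. Qed.

(** Polarization: the form is real on the families [x + y] and [x + i y]. *)
Lemma psd_herm K x y : psd K -> K y x = (K x y)^*.
Proof.
move=> psdK.
have kxx := ger0_Im (psd_diag x psdK); have kyy := ger0_Im (psd_diag y psdK).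
have h1 := ger0_Im (psdK [:: (1, x); (1, y)]).
have h2 := ger0_Im (psdK [:: (1, x); ('i, y)]).
move: h1 h2; rewrite /kform !big_cons !big_nil !addr0 /= conjC1 conjCi !mul1r !mulr1.
rewrite !cIm_add !cIm_mul !cRe_mul kxx kyy -complexiE /=.
case: (K x y) => a b; case: (K y x) => a' b' /= h1 h2.
by apply/eqP; rewrite eq_complex /=; apply/andP; split; apply/eqP; lra.
Qed.

Lemma kformD K G s : kform (fun x y => K x y + G x y) s = kform K s + kform G s.
Proof.
rewrite /kform -big_split /=; apply: eq_bigr => p _.
by rewrite -big_split /=; apply: eq_bigr => q _; rewrite mulrDr.
Qed.

Lemma kformZ K a s : kform (fun x y => a * K x y) s = a * kform K s.
Proof.
rewrite /kform mulr_sumr; apply: eq_bigr => p _.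
by rewrite mulr_sumr; apply: eq_bigr => q _; rewrite mulrCA.
Qed.

Lemma kform_gram (g h : X -> R[i]) s :
  kform (fun x y => g x * h y) s =
  (\sum_(p <- s) p.1^* * g p.2) * (\sum_(p <- s) p.1 * h p.2).
Proof.
rewrite /kform mulr_suml; apply: eq_bigr => p _.
by rewrite mulr_sumr; apply: eq_bigr => q _; rewrite mulrACA.
Qed.

Lemma psdD K G : psd K -> psd G -> psd (fun x y => K x y + G x y).
Proof. by move=> pK pG s; rewrite kformD addr_ge0. Qed.

Lemma psdZ K a : 0 <= a -> psd K -> psd (fun x y => a * K x y).
Proof. by move=> a0 pK s; rewrite kformZ mulr_ge0. Qed.

Lemma psd_gram (g : X -> R[i]) : psd (fun x y => g x * (g y)^*).
Proof.
move=> s; rewrite kform_gram.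
have -> : \sum_(p <- s) p.1 * (g p.2)^* = (\sum_(p <- s) p.1^* * g p.2)^*.
  by rewrite (rmorph_sum Num.conj) /=; apply: eq_bigr => p _; rewrite rmorphM /= conjCK.
exact: mul_conjC_ge0.
Qed.

Lemma psd_sum (I : Type) (r : seq I) (P : pred I) (F : I -> X -> X -> R[i]) :
  (forall i, P i -> psd (F i)) -> psd (fun x y => \sum_(i <- r | P i) F i x y).
Proof.
move=> pF; elim: r => [|i r ih].
  move=> s; rewrite /kform big1 // => p _; rewrite big1 // => q _.
  by rewrite big_nil mulr0.
have -> : (fun x y => \sum_(j <- i :: r | P j) F j x y) =
    fun x y => (if P i then F i x y else 0) + \sum_(j <- r | P j) F j x y.
  by apply/funext => x; apply/funext => y; rewrite big_cons; case: ifP; rewrite ?add0r.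
apply: psdD => //; case: (boolP (P i)) => [/pF//|_].
move=> s; rewrite /kform big1 // => p _; rewrite big1 // => q _.
by rewrite mulr0.
Qed.

Lemma psd_lim (F : nat -> X -> X -> R[i]) K :
  (forall n, psd (F n)) -> (forall x y, cvgC (fun n => F n x y) (K x y)) -> psd K.
Proof.
move=> pF FK s; apply: (@cvgC_ge0 _ (fun n => kform (F n) s)); last by move=> n; exact: pF.
by apply: cvgC_sum => p; apply: cvgC_sum => q; exact: cvgCZ.
Qed.

(** The Cauchy-Schwarz inequality between a family and the point [w], itself
    written as positivity of a kernel. *)
Lemma psd_cauchy_schwarz K w : psd K -> psd (fun x y => K w w * K x y - K x w * (K y w)^*).
Proof.
move=> pK s; pose b := \sum_(p <- s) p.1^* * K p.2 w.
have -> : kform (fun x y => K w w * K x y - K x w * (K y w)^*) s =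
    K w w * kform K s - b * b^*.
  have -> : (fun x y => K w w * K x y - K x w * (K y w)^*) =
      fun x y => K w w * K x y + (-1) * (K x w * (K y w)^*).
    by apply/funext => x; apply/funext => y; rewrite mulN1r.
  rewrite kformD !kformZ kform_gram mulN1r; congr (_ - _ * _).
  by rewrite (rmorph_sum Num.conj) /=; apply: eq_bigr => p _; rewrite rmorphM /= conjCK.
rewrite subr_ge0; apply: quad_disc; first exact: psd_diag.
move=> t; have := pK ((t, w) :: s).
congr (0 <= _); rewrite {1}/kform big_cons big_cons /=.
under [X in _ + X]eq_bigr do rewrite big_cons /=.
rewrite big_split /= -!addrA (mulrC t); congr (_ + _).
rewrite addrCA; congr (_ + (_ + _)).
  rewrite rmorphM /= /b (rmorph_sum Num.conj) mulr_sumr; apply: eq_bigr => p _.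
  by rewrite rmorphM /= conjCK -(psd_herm _ _ pK) mulrA.
by rewrite /b mulr_sumr; apply: eq_bigr => p _; rewrite mulrAC mulrC.
Qed.

End Form.

(** Replacing each point [y] by the combination [m y] covers pullback along a
    map, multiplication by a kernel [g x * (g y)^*] and congruence by a matrix of
    functions. *)
Lemma kform_combine (X Y : Type) (K : X -> X -> R[i]) (m : Y -> seq (R[i] * X)) s :
  kform (fun y y' => \sum_(p <- m y) \sum_(q <- m y') p.1^* * q.1 * K p.2 q.2) s =
  kform K (flatten [seq [seq (p.1 * q.1, q.2) | q <- m p.2] | p <- s]).
Proof.
rewrite /kform big_flatten big_map; apply: eq_bigr => p _; rewrite big_map.
under [RHS]eq_bigr do rewrite big_flatten big_map.
rewrite [RHS]exchange_big; apply: eq_bigr => q _ /=.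
rewrite mulr_sumr; apply: eq_bigr => a _; rewrite mulr_sumr big_map.
by apply: eq_bigr => b _ /=; rewrite rmorphM /=; ring.
Qed.

Lemma psd_combine (X Y : Type) (K : X -> X -> R[i]) (m : Y -> seq (R[i] * X)) :
  psd K ->
  psd (fun y y' => \sum_(p <- m y) \sum_(q <- m y') p.1^* * q.1 * K p.2 q.2).
Proof. by move=> pK s; rewrite kform_combine. Qed.

Lemma psd_pull (X Y : Type) (K : X -> X -> R[i]) (f : Y -> X) :
  psd K -> psd (fun y y' => K (f y) (f y')).
Proof.
move=> pK; have := psd_combine (fun y => [:: (1, f y)]) pK.
congr psd; apply/funext => y; apply/funext => y'.
by rewrite !big_seq1 /= conjC1 !mul1r.
Qed.

Lemma psd_mul_gram (X : Type) (K : X -> X -> R[i]) (g : X -> R[i]) :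
  psd K -> psd (fun x y => K x y * (g x * (g y)^*)).
Proof.
move=> pK; have := psd_combine (fun y => [:: ((g y)^*, y)]) pK.
congr psd; apply/funext => y; apply/funext => y'.
by rewrite !big_seq1 /= conjCK mulrC.
Qed.

End PositiveKernels.

(** * Hilbert space geometry of a reproducing kernel space *)
Section HilbertBasics.
Variables (R : realType) (X : Type) (K : X -> X -> R[i]) (H : rkhs K).
Implicit Types (f g h : X -> R[i]) (a b c : R[i]).
Local Notation dot := (rk_dot H).
Local Notation mem := (rk_set H).
Local Notation nrm := (hnorm H).

Lemma rk_setZ a f : mem f -> mem (fun x => a * f x).
Proof.
move=> hf; have := rk_setP a hf (rk_set0 H).
by congr rk_set; apply/funext => x; rewrite addr0.
Qed.

Lemma rk_setD f g : mem f -> mem g -> mem (f \+ g).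
Proof.
move=> hf hg; have := rk_setP 1 hf hg.
by congr rk_set; apply/funext => x; rewrite mul1r.
Qed.

Lemma rk_setB f g : mem f -> mem g -> mem (f \- g).
Proof.
move=> hf hg; have := rk_setP (-1) hg hf.
by congr rk_set; apply/funext => x; rewrite mulN1r addrC.
Qed.

Lemma rk_set_sum (I : Type) (s : seq I) (P : pred I) (F : I -> X -> R[i]) :
  (forall i, P i -> mem (F i)) -> mem (fun x => \sum_(i <- s | P i) F i x).
Proof.
move=> hF; elim: s => [|i s ih].
  by under eq_fun do rewrite big_nil; exact: rk_set0.
under eq_fun do rewrite big_cons.
by case: (boolP (P i)) => [Pi|_] //; apply: rk_setD => //; exact: hF.
Qed.

Lemma dot0l h : mem h -> dot (fun=> 0) h = 0.
Proof.
move=> hh; have := rk_dotP 1 (rk_set0 H) (rk_set0 H) hh.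
rewrite !mul1r addr0.
by move=> /eqP; rewrite -subr_eq0 opprD addrA subrr sub0r oppr_eq0 => /eqP.
Qed.

Lemma dotZl a f h : mem f -> mem h -> dot (fun x => a * f x) h = a * dot f h.
Proof.
move=> hf hh; have := rk_dotP a hf (rk_set0 H) hh.
by rewrite dot0l // addr0; under eq_fun do rewrite addr0.
Qed.

Lemma dotDl f g h : mem f -> mem g -> mem h -> dot (f \+ g) h = dot f h + dot g h.
Proof.
move=> hf hg hh; have := rk_dotP 1 hf hg hh.
by rewrite mul1r; under eq_fun do rewrite mul1r.
Qed.

Lemma dotBl f g h : mem f -> mem g -> mem h -> dot (f \- g) h = dot f h - dot g h.
Proof.
move=> hf hg hh; have := rk_dotP (-1) hg hf hh.
rewrite mulN1r addrC => <-; congr (dot _ _).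
by apply/funext => x; rewrite mulN1r addrC.
Qed.

Lemma dot_suml (I : Type) (s : seq I) (P : pred I) (F : I -> X -> R[i]) h :
  (forall i, P i -> mem (F i)) -> mem h ->
  dot (fun x => \sum_(i <- s | P i) F i x) h = \sum_(i <- s | P i) dot (F i) h.
Proof.
move=> hF hh; elim: s => [|i s ih].
  by rewrite big_nil; under eq_fun do rewrite big_nil; exact: dot0l.
rewrite big_cons; under eq_fun do rewrite big_cons.
case: (boolP (P i)) => [Pi|_] //; rewrite -ih; apply: dotDl => //; first exact: hF.
exact: rk_set_sum.
Qed.

Lemma dotZr a f h : mem f -> mem h -> dot f (fun x => a * h x) = a^* * dot f h.
Proof.
move=> hf hh; rewrite (rk_dotC (rk_setZ a hh) hf) dotZl // rmorphM /=.
by rewrite -(rk_dotC hh hf).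
Qed.

Lemma dotDr f g h : mem f -> mem g -> mem h -> dot h (f \+ g) = dot h f + dot h g.
Proof.
move=> hf hg hh; rewrite (rk_dotC (rk_setD hf hg) hh) dotDl // rmorphD /=.
by rewrite -!rk_dotC.
Qed.

Lemma dotBr f g h : mem f -> mem g -> mem h -> dot h (f \- g) = dot h f - dot h g.
Proof.
move=> hf hg hh; rewrite (rk_dotC (rk_setB hf hg) hh) dotBl // rmorphB /=.
by rewrite -!rk_dotC.
Qed.

Lemma dot_sumr (I : Type) (s : seq I) (P : pred I) (F : I -> X -> R[i]) h :
  (forall i, P i -> mem (F i)) -> mem h ->
  dot h (fun x => \sum_(i <- s | P i) F i x) = \sum_(i <- s | P i) dot h (F i).
Proof.
move=> hF hh; rewrite (rk_dotC (rk_set_sum _ hF) hh) dot_suml //.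
rewrite (rmorph_sum Num.conj); apply: eq_bigr => i /hF hFi.
by rewrite /= -rk_dotC.
Qed.

Lemma dot_hnorm f : mem f -> dot f f = (nrm f ^+ 2)%:C%C.
Proof.
move=> /(rk_dot_ge0 (r := H)) ff; rewrite /hnorm sqr_sqrtr.
  by rewrite RRe_real // ger0_real.
by rewrite -lecR RRe_real // ger0_real.
Qed.

Lemma hnorm_ge0 f : 0 <= nrm f.
Proof. exact: sqrtr_ge0. Qed.

Lemma hnorm0 : nrm (fun=> 0) = 0.
Proof. by rewrite /hnorm dot0l ?sqrtr0 //; exact: rk_set0. Qed.

Lemma hnorm_eq0 f : mem f -> nrm f = 0 -> f = fun=> 0.
Proof. by move=> hf f0; apply: (rk_dot_eq0 hf); rewrite dot_hnorm // f0 expr0n. Qed.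

Lemma hnormZ a f : mem f -> nrm (fun x => a * f x) = cabs a * nrm f.
Proof.
move=> hf; apply/eqP; rewrite -(@eqrXn2 _ 2) ?hnorm_ge0 ?mulr_ge0 ?cabs_ge0 ?hnorm_ge0 //.
apply/eqP/complexI; rewrite -dot_hnorm ?dotZl ?dotZr //; try exact: rk_setZ.
by rewrite dot_hnorm // exprMn [RHS]rmorphM /= cabs_sqr mulrA.
Qed.

Lemma cauchy_schwarz f g : mem f -> mem g -> cabs (dot f g) <= nrm f * nrm g.
Proof.
move=> hf hg; rewrite -cabsJ -(rk_dotC hf hg).
rewrite -(@ler_pXn2r _ 2) ?nnegrE ?cabs_ge0 ?mulr_ge0 ?hnorm_ge0 //.
rewrite -lecR cabs_sqr exprMn rmorphM /= -!dot_hnorm // (mulrC (dot f f)).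
apply: quad_disc; first exact: rk_dot_ge0.
move=> t; have htg := rk_setZ t hg; have hftg := rk_setD hf htg.
have := rk_dot_ge0 hftg; rewrite dotDl // !dotDr // dotZl // !dotZr // dotZl //.
by congr (0 <= _); rewrite rmorphM /= -(rk_dotC hg hf); ring.
Qed.

Lemma hnormD_sqr f g : mem f -> mem g ->
  nrm (f \+ g) ^+ 2 = nrm f ^+ 2 + complex.Re (dot f g) *+ 2 + nrm g ^+ 2.
Proof.
move=> hf hg; apply: complexI.
have -> (x y z : R) : (x + y + z)%:C%C = x%:C%C + y%:C%C + z%:C%C.
  by rewrite !rmorphD.
rewrite -addrJ -!dot_hnorm //; last exact: rk_setD.
rewrite dotDl ?dotDr -?(rk_dotC hf hg) //; last exact: rk_setD.
by rewrite !addrA.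
Qed.

Lemma hnormB_sqr f g : mem f -> mem g ->
  nrm (f \- g) ^+ 2 = nrm f ^+ 2 - complex.Re (dot f g) *+ 2 + nrm g ^+ 2.
Proof.
move=> hf hg; apply: complexI.
have -> (x y z : R) : (x - y + z)%:C%C = x%:C%C - y%:C%C + z%:C%C.
  by rewrite rmorphD rmorphB.
rewrite -addrJ -!dot_hnorm //; last exact: rk_setB.
rewrite dotBl ?dotBr -?(rk_dotC hf hg) //; last exact: rk_setB.
by ring.
Qed.

Lemma hnormD f g : mem f -> mem g -> nrm (f \+ g) <= nrm f + nrm g.
Proof.
move=> hf hg; rewrite -(@ler_pXn2r _ 2) ?nnegrE ?addr_ge0 ?hnorm_ge0 //.
rewrite hnormD_sqr // sqrrD lerD2r lerD2l lerMn2r /=.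
exact: le_trans (le_trans (ler_norm _) (Re_le_cabs _)) (cauchy_schwarz _ _).
Qed.

Lemma hnormN f : mem f -> nrm (fun x => - f x) = nrm f.
Proof.
move=> hf; under eq_fun do rewrite -mulN1r.
by rewrite hnormZ // cabsN cabs1 mul1r.
Qed.

Lemma hnormBC f g : mem f -> mem g -> nrm (f \- g) = nrm (g \- f).
Proof.
move=> hf hg; rewrite -hnormN; last exact: rk_setB.
by congr hnorm; apply/funext => x; rewrite opprB.
Qed.

Lemma hnormB f g : mem f -> mem g -> nrm f <= nrm g + nrm (f \- g).
Proof.
move=> hf hg; have := hnormD hg (rk_setB hf hg).
by congr (nrm _ <= _); apply/funext => x; rewrite /= addrC subrK.
Qed.

Lemma hnorm_triangle f g h : mem f -> mem g -> mem h ->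
  nrm (f \- h) <= nrm (f \- g) + nrm (g \- h).
Proof.
move=> hf hg hh; have := hnormD (rk_setB hf hg) (rk_setB hg hh).
by congr (nrm _ <= _); apply/funext => x; rewrite /= addrA subrK.
Qed.

Definition kernel_comb (s : seq (R[i] * X)) : X -> R[i] :=
  fun x => \sum_(p <- s) p.1 * K x p.2.

Lemma kernel_comb_mem s : mem (kernel_comb s).
Proof. by apply: rk_set_sum => p _; apply: rk_setZ; exact: rk_kernel. Qed.

Lemma dot_kernel_comb f s : mem f -> dot f (kernel_comb s) = \sum_(p <- s) p.1^* * f p.2.
Proof.
move=> hf; rewrite dot_sumr // => [|p _]; last by apply: rk_setZ; exact: rk_kernel.
by apply: eq_bigr => p _; rewrite dotZr ?rk_reproducing //; exact: rk_kernel.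
Qed.

Lemma hnorm_kernel_comb s : (nrm (kernel_comb s) ^+ 2)%:C%C = kform K s.
Proof.
rewrite -dot_hnorm ?dot_kernel_comb; try exact: kernel_comb_mem.
by apply: eq_bigr => p _; rewrite mulr_sumr; apply: eq_bigr => q _; rewrite mulrA.
Qed.

(** The functional that [f] would represent, if it belonged to the space, is
    bounded by [C] on combinations of kernel functions. *)
Lemma psd_sub_bound f (C : R) : 0 <= C ->
  (forall s, cabs (\sum_(p <- s) p.1^* * f p.2) <= C * nrm (kernel_comb s)) ->
  psd (fun x y => (C ^+ 2)%:C%C * K x y - f x * (f y)^*).
Proof.
move=> C0 hf s.
have -> : (fun x y => (C ^+ 2)%:C%C * K x y - f x * (f y)^*) =
    fun x y => (C ^+ 2)%:C%C * K x y + (-1) * (f x * (f y)^*).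
  by apply/funext => x; apply/funext => y; rewrite mulN1r.
rewrite kformD !kformZ kform_gram mulN1r subr_ge0.
have -> : \sum_(p <- s) p.1 * (f p.2)^* = (\sum_(p <- s) p.1^* * f p.2)^*.
  rewrite (rmorph_sum Num.conj); apply: eq_bigr => p _.
  by rewrite rmorphM /= conjCK.
rewrite -cabs_sqr -hnorm_kernel_comb -rmorphM lecR -exprMn.
by rewrite ler_pXn2r ?nnegrE ?cabs_ge0 ?mulr_ge0 ?hnorm_ge0.
Qed.

Lemma rk_psd_sub f : mem f ->
  psd (fun x y => (nrm f ^+ 2)%:C%C * K x y - f x * (f y)^*).
Proof.
move=> hf; apply: psd_sub_bound => [|s]; first exact: hnorm_ge0.
by rewrite -dot_kernel_comb //; apply: cauchy_schwarz => //; exact: kernel_comb_mem.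
Qed.

Lemma dot_cvg (u : nat -> X -> R[i]) f g :
  (forall n, mem (u n)) -> mem f -> mem g ->
  (fun n => nrm (u n \- f)) @ \oo --> (0 : R) ->
  cvgC (fun n => dot (u n) g) (dot f g).
Proof.
move=> hu hf hg uf.
apply: (@cvgC_squeeze _ _ _ (fun n => nrm (u n \- f) * nrm g)) => [n|].
  by rewrite -dotBl //; apply: cauchy_schwarz => //; exact: rk_setB.
by rewrite -(mul0r (nrm g)); apply: cvgM => //; exact: cvg_cst.
Qed.

Lemma eval_cvg (u : nat -> X -> R[i]) f w :
  (forall n, mem (u n)) -> mem f ->
  (fun n => nrm (u n \- f)) @ \oo --> (0 : R) ->
  cvgC (fun n => u n w) (f w).
Proof.
move=> hu hf uf; rewrite -(rk_reproducing w hf).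
under eq_fun do rewrite -(rk_reproducing w (hu _)).
exact: (dot_cvg hu hf (rk_kernel H w)).
Qed.

End HilbertBasics.

(** * Positivity implies membership *)
Section Membership.
Variables (R : realType) (X : Type) (K : X -> X -> R[i]) (H : rkhs K).
Variables (f : X -> R[i]) (C : R).
Hypothesis C_ge0 : 0 <= C.
Hypothesis f_dom : psd (fun x y => (C ^+ 2)%:C%C * K x y - f x * (f y)^*).
Implicit Types (s : seq (R[i] * X)) (a : R[i]).
Local Notation dot := (rk_dot H).
Local Notation mem := (rk_set H).
Local Notation nrm := (hnorm H).
Local Notation kernel_comb := (kernel_comb K).

(** The functional [h |-> dot h f] on kernel combinations, written down before
    [f] is known to belong to the space.  Minimizing [energy], which is
    [|h - f| ^ 2 - |f| ^ 2], produces a sequence converging to [f]. *)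
Let func s : R[i] := \sum_(p <- s) p.1 * (f p.2)^*.
Let energy s : R := nrm (kernel_comb s) ^+ 2 - complex.Re (func s) *+ 2.

Let scl a s := [seq (a * p.1, p.2) | p <- s].

Let comb_scl a s : kernel_comb (scl a s) = fun x => a * kernel_comb s x.
Proof.
apply/funext => x; rewrite /kernel_comb /scl big_map mulr_sumr.
by apply: eq_bigr => p _; rewrite mulrA.
Qed.

Let func_scl a s : func (scl a s) = a * func s.
Proof. by rewrite /func /scl big_map mulr_sumr; apply: eq_bigr => p _; rewrite mulrA. Qed.

Let comb_cat s t : kernel_comb (s ++ t) = kernel_comb s \+ kernel_comb t.
Proof. by apply/funext => x; rewrite /kernel_comb big_cat. Qed.

Let func_cat s t : func (s ++ t) = func s + func t.
Proof. by rewrite /func big_cat. Qed.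

Let func_le s : cabs (func s) <= C * nrm (kernel_comb s).
Proof.
rewrite -(@ler_pXn2r _ 2) ?nnegrE ?cabs_ge0 ?mulr_ge0 ?hnorm_ge0 //.
rewrite -lecR cabs_sqr exprMn rmorphM /= hnorm_kernel_comb -subr_ge0.
have := f_dom s; congr (0 <= _).
have -> : (fun x y => (C ^+ 2)%:C%C * K x y - f x * (f y)^*) =
    fun x y => (C ^+ 2)%:C%C * K x y + (-1) * (f x * (f y)^*).
  by apply/funext => x; apply/funext => y; rewrite mulN1r.
rewrite kformD !kformZ kform_gram mulN1r; congr (_ - _).
rewrite mulrC; congr (_ * _); rewrite (rmorph_sum Num.conj); apply: eq_bigr => p _.
by rewrite rmorphM /= conjCK.
Qed.

Let energy_lb s : - C ^+ 2 <= energy s.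
Proof.
have h := le_trans (le_trans (ler_norm _) (Re_le_cabs _)) (func_le s).
have := sqr_ge0 (nrm (kernel_comb s) - C); rewrite /energy mulr2n; nra.
Qed.

Let m := inf (range energy).

Let energy_has_inf : has_inf (range energy).
Proof.
split; first by exists (energy [::]), [::].
by exists (- C ^+ 2) => _ [s _ <-]; exact: energy_lb.
Qed.

Let energy_ge s : m <= energy s.
Proof. by apply: ge_inf; [case: energy_has_inf|exists s]. Qed.

Let minimizer n : exists s, energy s < m + n.+1%:R^-1.
Proof.
have e0 : 0 < n.+1%:R^-1 :> R by rewrite invr_gt0 ltr0n.
by have [_ [s _ <-] h] := inf_adherent e0 energy_has_inf; exists s.
Qed.

Let u n := projT1 (cid (minimizer n)).

Let u_energy n : energy (u n) < m + n.+1%:R^-1.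
Proof. by rewrite /u; case: cid. Qed.

(** Comparison of the energies of two families with that of their midpoint. *)
Let parallelogram s t :
  nrm (kernel_comb s \- kernel_comb t) ^+ 2 <= (energy s - m) *+ 2 + (energy t - m) *+ 2.
Proof.
have hs := kernel_comb_mem H s; have ht := kernel_comb_mem H t.
pose half : R[i] := (2^-1 : R)%:C%C.
have := energy_ge (scl half s ++ scl half t).
rewrite /energy comb_cat func_cat !comb_scl !func_scl -mulrDr.
have -> : (fun x => half * kernel_comb s x) \+ (fun x => half * kernel_comb t x) =
    fun x => half * (kernel_comb s \+ kernel_comb t) x.
  by apply/funext => x; rewrite /= mulrDr.
rewrite hnormZ; last exact: rk_setD.
rewrite cabs_real ger0_norm ?invr_ge0 // exprMn hnormD_sqr //.
rewrite hnormB_sqr // cRe_mul /= cRe_add mul0r subr0.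
by move=> ?; lra.
Qed.

(** Adding a small multiple of the kernel function at [w] cannot bring the
    energy below its infimum, so near minimizers are close to [f] at [w]. *)
Let variation s w :
  cabs (kernel_comb s w - f w) ^+ 2 <= (1 + nrm (K^~ w) ^+ 2) * (energy s - m).
Proof.
set k := nrm _ ^+ 2; set d := kernel_comb s w - f w.
have k0 : 0 <= k by exact: sqr_ge0.
have hs := kernel_comb_mem H s; have hk := rk_kernel H w.
pose l : R := (1 + k)^-1.
have l0 : 0 < l by rewrite invr_gt0 ltr_wpDr.
have lk : l * (1 + k) = 1 by rewrite mulVf // gt_eqF // ltr_wpDr.
(* the gradient direction, with a step short enough for the linear term to win *)
pose t : R[i] := - (l%:C%C * d).
have := energy_ge (s ++ [:: (t, w)]).
rewrite /energy comb_cat func_cat.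
have -> : kernel_comb [:: (t, w)] = fun x => t * K x w.
  by apply/funext => x; rewrite /kernel_comb big_seq1.
rewrite hnormD_sqr //; last exact: rk_setZ.
rewrite hnormZ // dotZr // rk_reproducing // {2}/func big_seq1 /= exprMn -/k.
have ct : cabs t ^+ 2 = l ^+ 2 * cabs d ^+ 2.
  by rewrite /t cabsN cabsM cabs_real ger0_norm ?exprMn // ltW.
have rt : complex.Re (t^* * kernel_comb s w) - complex.Re (t * (f w)^*) = - l * cabs d ^+ 2.
  have -> : complex.Re (t * (f w)^*) = complex.Re (t^* * f w).
    by rewrite -cRe_conj rmorphM /= conjCK.
  have -> : complex.Re (t^* * kernel_comb s w) - complex.Re (t^* * f w) =
      complex.Re (t^* * d).
    by rewrite /d mulrBr cRe_add; congr (_ + _); case: (_ * f w).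
  have -> // : t^* * d = (- l * cabs d ^+ 2)%:C%C.
  rewrite /t rmorphN rmorphM /= conj_realC [RHS]rmorphM /= cabs_sqr rmorphN /=.
  by ring.
rewrite cRe_add ct => h.
have : l * cabs d ^+ 2 <= energy s - m.
  rewrite /energy.
  have : l * k <= 1 by rewrite -lk mulrDr mulr1 lerDr ltW.
  have := sqr_ge0 (cabs d); nra.
have : 0 <= 1 + k by lra.
by move=> /ler_wpM2l h' /h'; rewrite mulrA (mulrC _ l) lk mul1r.
Qed.

Let cauchy (e : R) : 0 < e -> \forall n & k \near \oo,
  nrm (kernel_comb (u n) \- kernel_comb (u k)) < e.
Proof.
move=> e0.
have e4 : 0 < e ^+ 2 / 4 by rewrite divr_gt0 ?exprn_gt0.
have [N _ hN] := near_infty_natSinv_lt (PosNum e4).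
exists ([set n | (N <= n)%N], [set n | (N <= n)%N]); first by split; exists N.
move=> [n k] /= [hn hk].
have {}hn : n.+1%:R^-1 < e ^+ 2 / 4 := hN _ hn.
have {}hk : k.+1%:R^-1 < e ^+ 2 / 4 := hN _ hk.
rewrite -(@ltr_pXn2r _ 2) ?nnegrE ?hnorm_ge0 ?ltW //.
apply: le_lt_trans (parallelogram _ _) _.
have en : energy (u n) - m < n.+1%:R^-1 by rewrite ltrBlDl; exact: u_energy.
have ek : energy (u k) - m < k.+1%:R^-1 by rewrite ltrBlDl; exact: u_energy.
have := lt_trans en hn; have := lt_trans ek hk.
by set a := energy _ - m; set b := energy _ - m => ? ?; lra.
Qed.

(** The minimizing sequence is Cauchy by [parallelogram], and its limit agrees
    with [f] at every point by [variation].  The approximating sequence is kept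
    in the conclusion since it shows that kernel functions are total. *)
Lemma rk_membership : mem f /\ nrm f <= C /\
  exists v, (fun n => nrm (kernel_comb (v n) \- f)) @ \oo --> (0 : R).
Proof.
have [g hg ug] := rk_complete (fun n => kernel_comb_mem H (u n)) cauchy.
have gf : g = f.
  apply/funext => w.
  apply: (cvgC_unique (eval_cvg w (fun n => kernel_comb_mem H (u n)) hg ug)).
  pose k := 1 + nrm (K^~ w) ^+ 2.
  have k0 : 0 <= k by rewrite addr_ge0 ?sqr_ge0.
  apply: (@cvgC_squeeze _ _ _ (fun n => Num.sqrt (k * harmonic n))) => [n|].
    rewrite -(@ler_pXn2r _ 2) ?nnegrE ?cabs_ge0 ?sqrtr_ge0 //.
    rewrite sqr_sqrtr; last by rewrite mulr_ge0 // harmonic_ge0.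
    apply: le_trans (variation _ _) _; rewrite ler_wpM2l //.
    by rewrite lerBlDl ltW.
  rewrite -(@sqrtr0 R) -(mulr0 k).
  apply: (@cvg_comp _ _ _ (fun n => k * harmonic n) Num.sqrt _ (nbhs (k * 0)));
    last exact: sqrt_continuous.
  by apply: cvgM; [exact: cvg_cst|exact: cvg_harmonic].
rewrite {}gf in hg ug; split => //; split; last by exists u.
have hff : nrm f ^+ 2 <= C * nrm f.
  have h1 := cvgC_norm (dot_cvg (fun n => kernel_comb_mem H (u n)) hg hg ug).
  have h2 : (fun n => C * (nrm f + nrm (kernel_comb (u n) \- f))) @ \oo --> C * (nrm f + 0).
    by apply: cvgM; [exact: cvg_cst|apply: cvgD; [exact: cvg_cst|exact: ug]].
  rewrite addr0 in h2.
  have -> : nrm f ^+ 2 = cabs (dot f f).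
    by rewrite dot_hnorm // cabs_real ger0_norm ?sqr_ge0.
  apply: (ler_cvg_to h1 h2); apply: nearW => n.
  have hu := kernel_comb_mem H (u n).
  rewrite (rk_dotC hg hu) cabsJ dot_kernel_comb //.
  apply: (@le_trans _ _ (cabs (func (u n)))).
    rewrite le_eqVlt -cabsJ; apply/orP; left; apply/eqP; congr cabs.
    rewrite (rmorph_sum Num.conj); apply: eq_bigr => p _.
    by rewrite rmorphM /= conjCK.
  apply: le_trans (func_le _) _; rewrite ler_wpM2l //.
  exact: hnormB.
have := hnorm_ge0 H f; rewrite le_eqVlt => /orP[/eqP <- //|f0].
by move: hff; rewrite expr2 ler_pM2r.
Qed.

End Membership.

(** * Finite direct sums *)
Section DirectSum.
Variables (R : realType) (X : Type) (K : X -> X -> R[i]) (H : rkhs K) (r : nat).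
Implicit Types (f g h : 'I_r * X -> R[i]).

(** The space [H^r] is the reproducing kernel space on ['I_r * X] with this
    kernel, so matrices of multipliers need no separate vector-valued theory. *)
Definition dsum_kernel (p q : 'I_r * X) : R[i] := (p.1 == q.1)%:R * K p.2 q.2.

Definition component f (i : 'I_r) : X -> R[i] := fun x => f (i, x).

Definition dsum_set : set ('I_r * X -> R[i]) :=
  [set f | forall i, rk_set H (component f i)].

Definition dsum_dot f g : R[i] := \sum_i rk_dot H (component f i) (component g i).

Lemma dsum_hnorm f : dsum_set f ->
  Num.sqrt (complex.Re (dsum_dot f f)) = Num.sqrt (\sum_i hnorm H (component f i) ^+ 2).
Proof.
move=> hf; congr Num.sqrt; rewrite /dsum_dot.
under eq_bigr do rewrite dot_hnorm //.
by rewrite -(rmorph_sum (real_complex R)).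
Qed.

Lemma component_hnorm_le f i : dsum_set f ->
  hnorm H (component f i) <= Num.sqrt (complex.Re (dsum_dot f f)).
Proof.
move=> hf; rewrite dsum_hnorm // -(ger0_norm (hnorm_ge0 H (component f i))) -sqrtr_sqr.
rewrite ler_wsqrtr // (bigD1 i) //= lerDl.
by apply: sumr_ge0 => j _; exact: sqr_ge0.
Qed.

Fact dsum_set0 : dsum_set (fun=> 0).
Proof. by move=> i; exact: rk_set0. Qed.

Fact dsum_setP a f g : dsum_set f -> dsum_set g -> dsum_set (fun p => a * f p + g p).
Proof. by move=> hf hg i; exact: (rk_setP a (hf i) (hg i)). Qed.

Fact dsum_dotP a f g h : dsum_set f -> dsum_set g -> dsum_set h ->
  dsum_dot (fun p => a * f p + g p) h = a * dsum_dot f h + dsum_dot g h.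
Proof.
move=> hf hg hh; rewrite /dsum_dot mulr_sumr -big_split /=; apply: eq_bigr => i _.
exact: (rk_dotP a (hf i) (hg i) (hh i)).
Qed.

Fact dsum_dotC f g : dsum_set f -> dsum_set g -> dsum_dot g f = (dsum_dot f g)^*.
Proof.
move=> hf hg; rewrite /dsum_dot (rmorph_sum Num.conj); apply: eq_bigr => i _ /=.
exact: rk_dotC.
Qed.

Fact dsum_dot_ge0 f : dsum_set f -> 0 <= dsum_dot f f.
Proof. by move=> hf; apply: sumr_ge0 => i _; exact: rk_dot_ge0. Qed.

Fact dsum_dot_eq0 f : dsum_set f -> dsum_dot f f = 0 -> f = fun=> 0.
Proof.
move=> hf /eqP; rewrite psumr_eq0 => [/allP h|i _]; last exact: rk_dot_ge0.
apply/funext => -[i x]; have := h i (mem_index_enum i).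
by move=> /eqP /(rk_dot_eq0 (hf i)) /(congr1 (@^~ x)).
Qed.

Fact dsum_complete (u : nat -> 'I_r * X -> R[i]) :
  (forall n, dsum_set (u n)) ->
  (forall e : R, 0 < e -> \forall m & n \near \oo,
    Num.sqrt (complex.Re (dsum_dot (u m \- u n) (u m \- u n))) < e) ->
  exists2 f, dsum_set f &
    Num.sqrt (complex.Re (dsum_dot (u n \- f) (u n \- f))) @[n --> \oo]
      --> (0 : R).
Proof.
move=> hu ucauchy.
have hB f g : dsum_set f -> dsum_set g -> dsum_set (f \- g).
  by move=> hf hg i; exact: (rk_setB (hf i) (hg i)).
have lim_i i : exists2 f, rk_set H f &
    hnorm H (component (u n) i \- f) @[n --> \oo] --> (0 : R).
  apply: rk_complete => [n|e e0]; first exact: hu.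
  have := ucauchy e e0; apply: filterS => -[m n] /=; apply: le_lt_trans.
  by apply: (@component_hnorm_le (u m \- u n)); exact: hB.
pose f (p : 'I_r * X) := projT1 (cid2 (lim_i p.1)) p.2.
have fi i : component f i = projT1 (cid2 (lim_i i)) by [].
have hf : dsum_set f by move=> i; rewrite fi; case: cid2.
exists f => //.
under eq_fun => n do rewrite (dsum_hnorm (hB _ _ (hu n) hf)).
suff h : (fun n => \sum_(i < r) hnorm H (component (u n \- f) i) ^+ 2) @ \oo --> (0 : R).
  have := @cvg_comp _ _ _ (fun n => \sum_(i < r) hnorm H (component (u n \- f) i) ^+ 2)
    Num.sqrt _ _ _ h (@sqrt_continuous R 0).
  by rewrite sqrtr0.
have e0 : \sum_(i < r) (0 : R) = 0 by rewrite big1.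
rewrite -[X in _ --> X]e0; apply: cvgn_sum => i.
rewrite -[X in _ --> X](mulr0 0); under eq_fun do rewrite expr2.
have : hnorm H (component (u n) i \- component f i) @[n --> \oo] --> (0 : R).
  by rewrite fi; case: cid2.
by move=> h; apply: cvgM.
Qed.

Fact dsum_kernel_comp (w : 'I_r * X) i :
  component (dsum_kernel^~ w) i = fun x => (i == w.1)%:R * K x w.2.
Proof. by []. Qed.

Fact dsum_kernel_mem w : dsum_set (dsum_kernel^~ w).
Proof. by move=> i; rewrite dsum_kernel_comp; apply: rk_setZ; exact: rk_kernel. Qed.

Fact dsum_reproducing f w : dsum_set f -> dsum_dot f (dsum_kernel^~ w) = f w.
Proof.
move=> hf; case: w => j w; rewrite /dsum_dot (bigD1 j) //= big1 => [|i ij].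
  rewrite addr0 dsum_kernel_comp eqxx dotZr ?rk_reproducing //; last exact: rk_kernel.
  by rewrite conjC1 mul1r.
rewrite dsum_kernel_comp (negbTE ij) dotZr //; last exact: rk_kernel.
by rewrite conjC0 mul0r.
Qed.

Definition dsum : rkhs dsum_kernel :=
  RKHS dsum_set0 dsum_setP dsum_dotP dsum_dotC dsum_dot_ge0 dsum_dot_eq0
    dsum_complete dsum_kernel_mem dsum_reproducing.

Definition curry_fam (F : 'I_r -> X -> R[i]) : 'I_r * X -> R[i] := fun p => F p.1 p.2.

Lemma hpow_normE (F : 'I_r -> X -> R[i]) : hpow H F ->
  hpow_norm H F = hnorm dsum (curry_fam F).
Proof. by move=> hF; rewrite [RHS](@dsum_hnorm (curry_fam F)). Qed.

End DirectSum.

(** * Bounded multipliers and positive kernels *)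
Section MultiplierBounds.
Variables (R : realType) (X : Type) (K : X -> X -> R[i]) (H : rkhs K).

Section Matrix.
Variables (r : nat) (F : 'M[X -> R[i]]_r) (M : R).
Hypothesis M_ge0 : 0 <= M.
Local Notation Hr := (dsum H r).
Implicit Types (p q : 'I_r * X) (f : 'I_r * X -> R[i]).

(** The entries of [M ^ 2 - F F^*]. *)
Definition mult_defect p q : R[i] :=
  (M ^+ 2)%:C%C * (p.1 == q.1)%:R - \sum_l F p.1 l p.2 * (F q.1 l q.2)^*.

Definition mx_mul f : 'I_r * X -> R[i] := fun p => \sum_j F p.1 j p.2 * f (j, p.2).

(** The adjoint of multiplication by [F] sends the kernel function at [p] to the
    combination [m p]. *)
Let m p := [seq ((F p.1 j p.2)^*, (j, p.2)) | j <- index_enum 'I_r].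

Let sum_m (G : 'I_r * X -> 'I_r * X -> R[i]) p q :
  \sum_(a <- m p) \sum_(b <- m q) a.1^* * b.1 * G a.2 b.2 =
  \sum_j \sum_l F p.1 j p.2 * (F q.1 l q.2)^* * G (j, p.2) (l, q.2).
Proof.
rewrite big_map; apply: eq_bigr => j _; rewrite big_map; apply: eq_bigr => l _ /=.
by rewrite conjCK.
Qed.

Let sum_m_kernel p q :
  \sum_(a <- m p) \sum_(b <- m q) a.1^* * b.1 * dsum_kernel K a.2 b.2 =
  (\sum_l F p.1 l p.2 * (F q.1 l q.2)^*) * K p.2 q.2.
Proof.
rewrite sum_m mulr_suml; apply: eq_bigr => j _; rewrite (bigD1 j) //= big1 => [|l lj].
  by rewrite /dsum_kernel /= eqxx mul1r addr0.
by rewrite /dsum_kernel /= eq_sym (negbTE lj) mul0r mulr0.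
Qed.

(** For a combination of kernel functions, positivity says that the image [f]
    under the adjoint of multiplication is at most [M] times as long.  This
    follows from the bound on [F f], by pairing [F f] with the combination. *)
Lemma psd_mult_defect :
  (forall f, rk_set Hr f -> rk_set Hr (mx_mul f) /\ hnorm Hr (mx_mul f) <= M * hnorm Hr f) ->
  psd (fun p q => mult_defect p q * K p.2 q.2).
Proof.
move=> FM s.
have -> : (fun p q => mult_defect p q * K p.2 q.2) =
    fun p q => (M ^+ 2)%:C%C * dsum_kernel K p q +
    (-1) * \sum_(a <- m p) \sum_(b <- m q) a.1^* * b.1 * dsum_kernel K a.2 b.2.
  apply/funext => p; apply/funext => q; rewrite sum_m_kernel.
  by rewrite /mult_defect /dsum_kernel; ring.
rewrite kformD !kformZ kform_combine -!(hnorm_kernel_comb Hr).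
set t := flatten _; set f := kernel_comb _ t.
rewrite mulN1r subr_ge0 -rmorphM lecR -exprMn.
have hf : rk_set Hr f by exact: kernel_comb_mem.
have [hFf Ff_le] := FM f hf.
rewrite ler_pXn2r ?nnegrE ?mulr_ge0 ?hnorm_ge0 //.
have key : hnorm Hr f ^+ 2 <= M * hnorm Hr f * hnorm Hr (kernel_comb (@dsum_kernel R X K r) s).
  apply: (@le_trans _ _ (cabs (rk_dot Hr (mx_mul f)
      (kernel_comb (@dsum_kernel R X K r) s)))); last first.
    apply: le_trans (cauchy_schwarz hFf (kernel_comb_mem Hr s)) _.
    by rewrite ler_wpM2r ?hnorm_ge0.
  have -> : rk_dot Hr (mx_mul f) (kernel_comb (@dsum_kernel R X K r) s) = rk_dot Hr f f.
    rewrite {3}/f !dot_kernel_comb // /t big_flatten big_map; apply: eq_bigr => p _.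
    rewrite !big_map /mx_mul mulr_sumr; apply: eq_bigr => j _ /=.
    by rewrite rmorphM /= conjCK mulrA.
  by rewrite dot_hnorm // cabs_real ler_norm.
have := hnorm_ge0 Hr f; rewrite le_eqVlt => /orP[/eqP <-|f0].
  by rewrite mulr_ge0 // hnorm_ge0.
by move: key; rewrite expr2 mulrAC ler_pM2r.
Qed.

(** By [rk_membership] it suffices that [(M |f|) ^ 2 K - (F f) (F f)^*] is
    positive.  It is [|f| ^ 2] times the given kernel plus the image of the
    positive kernel [|f| ^ 2 K - f f^*] under congruence by [F]. *)
Lemma mult_defect_psd : psd (fun p q => mult_defect p q * K p.2 q.2) ->
  forall f, rk_set Hr f -> rk_set Hr (mx_mul f) /\ hnorm Hr (mx_mul f) <= M * hnorm Hr f.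
Proof.
move=> pF f hf.
have C0 : 0 <= M * hnorm Hr f by rewrite mulr_ge0 // hnorm_ge0.
suff h : psd (fun p q => ((M * hnorm Hr f) ^+ 2)%:C%C * dsum_kernel K p q -
    mx_mul f p * (mx_mul f q)^*).
  by have [? []] := @rk_membership _ _ _ Hr _ _ C0 h.
have f0 : 0 <= (hnorm Hr f ^+ 2)%:C%C :> R[i] by rewrite ler0c sqr_ge0.
have := psdD (psdZ f0 pF) (psd_combine m (rk_psd_sub hf)).
congr psd; apply/funext => p; apply/funext => q.
have -> : \sum_(a <- m p) \sum_(b <- m q) a.1^* * b.1 *
    ((hnorm Hr f ^+ 2)%:C%C * dsum_kernel K a.2 b.2 - f a.2 * (f b.2)^*) =
    (hnorm Hr f ^+ 2)%:C%C * (\sum_(a <- m p) \sum_(b <- m q)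
       a.1^* * b.1 * dsum_kernel K a.2 b.2) - mx_mul f p * (mx_mul f q)^*.
  rewrite (sum_m (fun a b => (hnorm Hr f ^+ 2)%:C%C * dsum_kernel K a b - f a * (f b)^*)).
  rewrite (sum_m (@dsum_kernel R X K r)) (rmorph_sum Num.conj) mulr_suml mulr_sumr -sumrB.
  apply: eq_bigr => j _; rewrite !mulr_sumr -sumrB; apply: eq_bigr => l _ /=.
  by rewrite rmorphM /=; ring.
by rewrite sum_m_kernel /mult_defect /dsum_kernel exprMn rmorphM /=; ring.
Qed.

End Matrix.

Section UniformBoundedness.
Variable phi : X -> R[i].
Hypothesis phi_mult : Mult H phi.
Implicit Types (f g h : X -> R[i]).
Local Notation dot := (rk_dot H).
Local Notation mem := (rk_set H).
Local Notation nrm := (hnorm H).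

(** If multiplication by [phi] exceeds the bound [M], it does so against some
    kernel combination; moving [phi] to the other side of the inner product
    gives a bounded functional of norm more than [M] which stays below the norm
    of [phi \* g] at every [g]. *)
Let large_functional (M : R) : 0 <= M ->
  ~ (forall f, mem f -> nrm (phi \* f) <= M * nrm f) ->
  exists h, [/\ mem h, M < nrm h & forall g, mem g -> cabs (dot g h) <= nrm (phi \* g)].
Proof.
move=> M0 /existsNP[f] /not_implyP[hf /negP]; rewrite -ltNge => Mf.
have hpf : mem (phi \* f) by exact: phi_mult.
have Mf0 : 0 <= M * nrm f by rewrite mulr_ge0 ?hnorm_ge0.
have [s] : exists s, M * nrm f * nrm (kernel_comb K s) <
    cabs (dot (phi \* f) (kernel_comb K s)).
  apply: contrapT => hs.
  have [] := @rk_membership _ _ _ H (phi \* f) _ Mf0.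
    apply: (psd_sub_bound (H := H)) => // s.
    rewrite -(dot_kernel_comb (H := H)) // leNgt; apply/negP => h.
    by apply: hs; exists s.
  by move=> _ [h _]; move: Mf; rewrite ltNge h.
move=> hs; have hc := kernel_comb_mem H s.
have c0 : 0 < nrm (kernel_comb K s).
  rewrite lt_neqAle hnorm_ge0 andbT; apply/negP => /eqP c0.
  have := cauchy_schwarz hpf hc; rewrite -c0 mulr0 => h.
  by move: hs; rewrite -c0 mulr0 ltNge h.
pose k := kernel_comb K [seq (p.1 * (phi p.2)^*, p.2) | p <- s].
have hk : mem k by exact: kernel_comb_mem.
have dotk g : mem g -> dot g k = dot (phi \* g) (kernel_comb K s).
  move=> hg; rewrite !dot_kernel_comb //; last exact: phi_mult.
  rewrite big_map; apply: eq_bigr => p _ /=.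
  by rewrite rmorphM /= conjCK mulrA.
pose a : R := (nrm (kernel_comb K s))^-1.
have a0 : 0 < a by rewrite invr_gt0.
have cabsa : cabs (a%:C%C : R[i]) = a by rewrite cabs_real ger0_norm // ltW.
have bound g : mem g -> cabs (dot g (fun x => a%:C%C * k x)) =
    a * cabs (dot (phi \* g) (kernel_comb K s)).
  by move=> hg; rewrite dotZr // cabsM cabsJ cabsa dotk.
exists (fun x => a%:C%C * k x); split; first exact: rk_setZ.
  have h := cauchy_schwarz hf (rk_setZ a%:C%C hk); rewrite bound // in h.
  have : nrm f * M < nrm f * nrm (fun x => a%:C%C * k x).
    apply: lt_le_trans h; rewrite -(@ltr_pM2r _ (nrm (kernel_comb K s))) //.
    by rewrite (mulrC (nrm f)) (mulrC a) -(mulrA _ a) mulVf ?mulr1 ?gt_eqF.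
  have := hnorm_ge0 H f; rewrite le_eqVlt => /orP[/eqP <-|f0].
    by rewrite !mul0r ltxx.
  by rewrite ltr_pM2l.
move=> g hg; rewrite bound //.
rewrite -ler_pdivlMl // invrK mulrC; apply: cauchy_schwarz => //.
exact: phi_mult.
Qed.

(** A move of length [e] in the direction of [h], with the sign chosen so that
    the pairing with [h] becomes at least [e * nrm h]: one of the two signs
    works, since the two pairings differ by twice that amount. *)
Let step (h : X -> R[i]) (e : R) (x : X -> R[i]) : X -> R[i] :=
  let t : R[i] := (e / nrm h)%:C%C in
  let y := x \+ (fun z => t * h z) in
  if e * nrm h <= cabs (dot y h) then y else x \- (fun z => t * h z).

Let stepP h e x : 0 <= e -> mem h -> 0 < nrm h -> mem x ->
  [/\ mem (step h e x), nrm (step h e x \- x) <= e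
     & e * nrm h <= cabs (dot (step h e x) h)].
Proof.
move=> e0 hh h0 hx; rewrite /step; set t : R[i] := (e / _)%:C%C.
have hth := rk_setZ t hh.
have nt : nrm (fun z => t * h z) = e.
  rewrite hnormZ // cabs_real ger0_norm ?divr_ge0 ?hnorm_ge0 //.
  by rewrite divfK // gt_eqF.
have ta : t * dot h h = (e * nrm h)%:C%C.
  rewrite dot_hnorm // -rmorphM /=; congr (_%:C%C).
  by rewrite expr2 mulrA divfK // gt_eqF.
case: ifPn => [le|]; last rewrite -ltNge => lt.
  split=> //; first exact: rk_setD.
  rewrite (_ : _ \- _ = fun z => t * h z) ?nt //.
  by apply/funext => z /=; rewrite addrAC subrr add0r.
split; first exact: rk_setB.
  rewrite (_ : _ \- _ = fun z => - (t * h z)) ?hnormN ?nt //.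
  by apply/funext => z /=; rewrite addrAC subrr add0r.
rewrite dotBl // dotZl // ta; rewrite dotDl // dotZl // ta in lt.
set d := dot x h in lt *; set c := e * nrm h in lt *.
have c0 : 0 <= c by rewrite mulr_ge0 ?hnorm_ge0.
have := cabsD (d + c%:C%C) (- (d - c%:C%C)); rewrite cabsN.
have -> : d + c%:C%C + - (d - c%:C%C) = (c *+ 2)%:C%C.
  by rewrite rmorphMn /=; ring.
rewrite cabs_real ger0_norm ?mulrn_wge0 // mulr2n => h2; lra.
Qed.

(** Sokal's proof of the uniform boundedness principle.  Steps of length [3^-n]
    towards functionals [h n] of norm more than [n * 3^n] give a Cauchy sequence;
    all later steps together have length at most half of the [n]-th one, so
    they cannot undo what it achieves, and the norm of [phi \* y] at the limit
    [y] is at least [n / 2] for every [n]. *)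
Lemma mult_bounded :
  exists2 M : R, 0 <= M & forall f, mem f -> nrm (phi \* f) <= M * nrm f.
Proof.
apply: contrapT => unbounded.
pose w n : R := 3^-1 ^+ n.
have w0 n : 0 < w n by rewrite exprn_gt0 // invr_gt0.
have wS n : w n = 3 * w n.+1 by rewrite /w exprS mulrA divff ?mul1r.
have /choice[h hP] n : exists h, [/\ mem h, n%:R / w n < nrm h
    & forall g, mem g -> cabs (dot g h) <= nrm (phi \* g)].
  have h0 : 0 <= n%:R / w n by rewrite divr_ge0 // ltW.
  by apply: large_functional => // h; apply: unbounded; exists (n%:R / w n).
pose x := fix x n := if n is k.+1 then step (h k) (w k) (x k) else fun=> 0.
have hpos n : 0 < nrm (h n).
  by have [_ + _] := hP n; apply: le_lt_trans; rewrite divr_ge0 // ltW.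
have hx n : mem (x n).
  elim: n => [|n ih]; first exact: rk_set0.
  by have [hh _ _] := hP n; have [] := stepP (ltW (w0 n)) hh (hpos n) ih.
have xstep n : nrm (x n.+1 \- x n) <= w n.
  by have [hh _ _] := hP n; have [] := stepP (ltW (w0 n)) hh (hpos n) (hx n).
have xdot n : w n * nrm (h n) <= cabs (dot (x n.+1) (h n)).
  by have [hh _ _] := hP n; have [] := stepP (ltW (w0 n)) hh (hpos n) (hx n).
have xdist n k : nrm (x (n + k)%N \- x n) <= 3 / 2 * (w n - w (n + k)%N).
  elim: k => [|k ih].
    rewrite addn0 subrr mulr0 (_ : _ \- _ = fun=> 0) ?hnorm0 //.
    by apply/funext => z; rewrite /= subrr.
  rewrite addnS; apply: le_trans (hnorm_triangle (hx _) (hx (n + k)%N) (hx n)) _.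
  have := xstep (n + k)%N; have := wS (n + k)%N; lra.
have xdist' n k : (n <= k)%N -> nrm (x k \- x n) <= 3 / 2 * w n.
  move=> nk; have := xdist n (k - n)%N; rewrite subnKC //.
  by have := w0 k; lra.
have w_cvg : w @ \oo --> (0 : R).
  by apply: cvg_expr; rewrite ger0_norm ?invr_ge0 // invf_lt1 // ltr1n.
have [] := rk_complete hx.
  move=> e e0; have e6 : 0 < e / 6 by rewrite divr_gt0.
  move/cvgr0Pnorm_lt: w_cvg => /(_ _ e6)[N _ hN].
  exists ([set n | (N <= n)%N], [set n | (N <= n)%N]); first by split; exists N.
  move=> [n k] /= [hn hk].
  have {}hN : w N < e / 6.
    by have := hN N (leqnn N); rewrite /= ger0_norm // ltW.
  apply: le_lt_trans (hnorm_triangle (hx n) (hx N) (hx k)) _.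
  rewrite (hnormBC (hx N) (hx k)).
  have := xdist' _ _ hn; have := xdist' _ _ hk; lra.
move=> y hy xy.
have ydist n : nrm (y \- x n.+1) <= w n / 2.
  have h1 : (fun k => nrm (x k \- y) + 3 / 2 * w n.+1) @ \oo --> 0 + 3 / 2 * w n.+1.
    by apply: cvgD; [exact: xy|exact: cvg_cst].
  have -> : w n / 2 = 0 + 3 / 2 * w n.+1 by rewrite wS; field.
  apply: (cvgr_to_ge h1); exists n.+1 => // k /= nk.
  apply: le_trans (hnorm_triangle hy (hx k) (hx n.+1)) _.
  by rewrite (hnormBC hy (hx k)) lerD2l xdist'.
have ylarge n : n%:R / 2 <= nrm (phi \* y).
  have [hh hn hle] := hP n.
  apply: le_trans (hle y hy).
  have h1 := xdot n.
  have h2 := cabsD (dot y (h n)) (- dot (y \- x n.+1) (h n)).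
  rewrite cabsN dotBl // opprB addrC subrK in h2.
  have h3 := cauchy_schwarz (rk_setB hy (hx n.+1)) hh; rewrite dotBl // in h3.
  have h4 := ler_wpM2r (hnorm_ge0 H (h n)) (ydist n).
  have h5 : n%:R < w n * nrm (h n) by rewrite mulrC -ltr_pdivrMr.
  lra.
pose n := Num.trunc (2 * nrm (phi \* y)).
have := ylarge n.+1.
have : 2 * nrm (phi \* y) < n.+1%:R by exact: truncnS_gt.
lra.
Qed.

End UniformBoundedness.

End MultiplierBounds.

(** * Words *)
Section Words.
Variable T : finType.
Implicit Types (u v : seq T).

Fixpoint words m : seq (seq T) :=
  if m is k.+1 then [seq i :: u | i <- enum T, u <- words k] else [:: [::]].

Lemma mem_words m u : (u \in words m) = (size u == m).
Proof.
elim: m u => [|m ih] [|i u] //=.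
  by apply/negbTE/allpairsP => -[[j v] []].
rewrite eqSS -ih; apply/allpairsP/idP => [[[j v] /= [_ hv [_ ->]]]//|hu].
by exists (i, u); rewrite mem_enum.
Qed.

Lemma words_uniq m : uniq (words m).
Proof.
elim: m => //= m ih; apply: allpairs_uniq => //; first exact: enum_uniq.
by move=> [i u] [j v] /= _ _ [-> ->].
Qed.

Lemma sum_words_cat (V : nmodType) (G : seq T -> V) a b :
  \sum_(u <- words (a + b)) G u = \sum_(u <- words a) \sum_(v <- words b) G (u ++ v).
Proof.
elim: a G => [|a ih] G; first by rewrite big_seq1.
rewrite addSn /= !big_allpairs_dep; apply: eq_bigr => i _.
by rewrite (ih (fun u => G (i :: u))).
Qed.

Lemma sum_words_prod (A : comNzRingType) (t : T -> A) m :
  \sum_(u <- words m) \prod_(i <- u) t i = (\sum_i t i) ^+ m.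
Proof.
elim: m => [|m ih]; first by rewrite big_seq1 big_nil.
rewrite /= big_allpairs_dep exprS -ih mulr_suml big_enum /=; apply: eq_bigr => i _.
by rewrite mulr_sumr; apply: eq_bigr => u _; rewrite big_cons.
Qed.

End Words.

(** * Kernels carried by sets of words *)
Section WordKernels.
Variables (R : realType) (d : nat).
Local Notation ball := (unit_ball R d).
Implicit Types (z w : ball) (u v : seq 'I_d) (P : pred (seq 'I_d)) (m n : nat).

Definition mono u z : R[i] := \prod_(i <- u) val z 0 i.

(** The kernel carried by a set [P] of words, as a series in the length of the
    words.  Distinct words may spell the same monomial; keeping them apart
    avoids multinomial coefficients and makes concatenation of words the only
    combinatorial operation. *)
Definition wker_deg P m z w : R[i] := \sum_(u <- words 'I_d m | P u) mono u z * (mono u w)^*.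

Definition radius z w : R := \sum_i cabs (val z 0 i) * cabs (val w 0 i).

Lemma ball_lt1 z : \sum_i cabs (val z 0 i) ^+ 2 < 1.
Proof.
case: z => z /=; rewrite -ltcR (rmorph_sum (real_complex R)) rmorph1.
by congr (_ < _); apply: eq_bigr => i _; rewrite normr_cabs -rmorphXn.
Qed.

Lemma radius_bound z w : 0 <= radius z w < 1.
Proof.
rewrite sumr_ge0 /= => [|i _]; last by rewrite mulr_ge0 ?cabs_ge0.
have : \sum_i (cabs (val z 0 i) ^+ 2 + cabs (val w 0 i) ^+ 2) < 1 + 1.
  by rewrite big_split ltrD ?ball_lt1.
have : (radius z w) *+ 2 <= \sum_i (cabs (val z 0 i) ^+ 2 + cabs (val w 0 i) ^+ 2).
  rewrite /radius -sumrMnl; apply: ler_sum => i _.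
  by have := sqr_ge0 (cabs (val z 0 i) - cabs (val w 0 i)); rewrite mulr2n; nra.
by rewrite mulr2n; lra.
Qed.

Lemma cabs_prod (I : Type) (s : seq I) (F : I -> R[i]) :
  cabs (\prod_(i <- s) F i) = \prod_(i <- s) cabs (F i).
Proof.
elim/big_rec2: _ => [|i x y _ <-]; last by rewrite cabsM.
by rewrite cabs1.
Qed.

Lemma wker_deg_bound P m z w : cabs (wker_deg P m z w) <= radius z w ^+ m.
Proof.
apply: le_trans (cabs_sum _ _ _) _; rewrite -sum_words_prod [leRHS](bigID P) /=.
rewrite -[leLHS]addr0; apply: lerD.
  apply: ler_sum => u _; rewrite cabsM cabsJ /mono !cabs_prod -big_split.
  exact: lexx.
apply: sumr_ge0 => u _; apply: prodr_ge0 => i _.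
by rewrite mulr_ge0 ?cabs_ge0.
Qed.

Lemma wker_ex P z w : exists l, cvgC (fun n => \sum_(m < n) wker_deg P m z w) l.
Proof. exact: cvgC_geo_series (radius_bound z w) (fun m => wker_deg_bound P m z w). Qed.

Definition wker P z w : R[i] := projT1 (cid (wker_ex P z w)).

Lemma wker_cvg P z w : cvgC (fun n => \sum_(m < n) wker_deg P m z w) (wker P z w).
Proof. by rewrite /wker; case: cid. Qed.

Lemma psd_wker_deg P m : psd (wker_deg P m).
Proof. by apply: psd_sum => u _; exact: psd_gram. Qed.

Lemma psd_wker P : psd (wker P).
Proof.
apply: (@psd_lim _ _ (fun n z w => \sum_(m < n) wker_deg P m z w)) => [n|z w]; last exact: wker_cvg.
by apply: psd_sum => m _; exact: psd_wker_deg.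
Qed.

Lemma wker_deg_predT m z w : wker_deg predT m z w = (\sum_i val z 0 i * (val w 0 i)^*) ^+ m.
Proof.
rewrite -sum_words_prod; apply: eq_bigr => u _.
by rewrite /mono (rmorph_prod Num.conj) -big_split.
Qed.

Lemma wker_predT z w : wker predT z w = DA_kernel z w.
Proof.
apply: cvgC_unique (wker_cvg _ _ _) _; rewrite /DA_kernel.
set x := \sum_i _.
have hx : cabs x < 1.
  have /andP[_] := radius_bound z w; apply: le_lt_trans.
  by have := wker_deg_bound predT 1 z w; rewrite wker_deg_predT !expr1.
have x1 : 1 - x != 0.
  apply/eqP => /subr0_eq x1; move: hx; rewrite -x1.
  by rewrite cabs1 ltxx.
have h : cvgC (fun n => x ^+ n) 0.
  apply: (@cvgC_squeeze _ _ _ (fun n => cabs x ^+ n)) => [n|].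
    rewrite subr0; elim: n => [|n ih].
      by rewrite !expr0 cabs1.
    by rewrite !exprS cabsM ler_wpM2l ?cabs_ge0.
  by apply: cvg_expr; rewrite ger0_norm ?cabs_ge0.
have := cvgCZ (1 - x)^-1 (cvgCB (cvgC_cst 1) h); rewrite subr0 mulr1.
apply: cvgC_near; exists 0%N => n _.
under eq_bigr do rewrite wker_deg_predT.
rewrite -/x -[1 - x ^+ n]opprB subrX1 -mulNr opprB mulrA mulVf // mul1r.
by [].
Qed.

Lemma wker_deg_split P Q m z w :
  wker_deg P m z w =
  wker_deg (fun u => P u && Q u) m z w + wker_deg (fun u => P u && ~~ Q u) m z w.
Proof. by rewrite /wker_deg (bigID Q). Qed.

Lemma wker_split P Q z w :
  wker P z w = wker (fun u => P u && Q u) z w + wker (fun u => P u && ~~ Q u) z w.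
Proof.
apply: cvgC_unique (wker_cvg _ _ _) _.
have := cvgCD (wker_cvg (fun u => P u && Q u) z w) (wker_cvg (fun u => P u && ~~ Q u) z w).
apply: cvgC_near; exists 0%N => n _; rewrite -big_split /=.
by apply: eq_bigr => m _; rewrite -wker_deg_split.
Qed.

Lemma eq_wker_deg P Q m z w : (forall u, size u = m -> P u = Q u) ->
  wker_deg P m z w = wker_deg Q m z w.
Proof.
move=> PQ; rewrite /wker_deg big_seq_cond [RHS]big_seq_cond; apply: eq_bigl => u.
by case: (boolP (u \in _)) => //=; rewrite mem_words => /eqP /PQ.
Qed.

Lemma eq_wker P Q z w : P =1 Q -> wker P z w = wker Q z w.
Proof.
move=> PQ; apply: cvgC_unique (wker_cvg P z w) _.
apply: cvgC_near (wker_cvg Q z w); exists 0%N => n _.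
by apply: eq_bigr => m _; apply: eq_wker_deg => u _; rewrite PQ.
Qed.

Lemma wkerC P z w : DA_kernel z w = wker P z w + wker (fun u => ~~ P u) z w.
Proof. by rewrite -wker_predT (wker_split predT P). Qed.

Lemma wker_finite P N z w : (forall u, P u -> (size u < N)%N) ->
  wker P z w = \sum_(m < N) wker_deg P m z w.
Proof.
move=> PN; apply: cvgC_unique (wker_cvg _ _ _) _.
apply: cvgC_near (cvgC_cst _); exists N => n Nn.
rewrite (big_ord_widen n (fun m => wker_deg P m z w)) // [RHS](bigID (fun m : 'I_n => m < N)%N) /=.
rewrite [X in _ = _ + X]big1 ?addr0 // => m; rewrite -leqNgt => Nm.
rewrite /wker_deg big_seq_cond big1 // => u /andP[]; rewrite mem_words => /eqP us /PN.
by rewrite us ltnNge Nm.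
Qed.

(** The tail of the series is again the kernel of a set of words, so that it is
    positive and dominated by the full kernel. *)
Lemma wker_tail P N z w :
  wker P z w = \sum_(m < N) wker_deg P m z w + wker (fun u => P u && (N <= size u)%N) z w.
Proof.
rewrite (wker_split P (fun u => (size u < N)%N)) (wker_finite (N := N)) => [|u /andP[]//].
congr (_ + _).
  apply: eq_bigr => m _; apply: eq_wker_deg => u um /=.
  by rewrite um ltn_ord andbT.
by apply: eq_wker => u /=; rewrite -leqNgt.
Qed.

Lemma wker_tail_cvg P w :
  cvgC (fun N => wker (fun u => P u && (N <= size u)%N) w w) 0.
Proof.
have := cvgCB (cvgC_cst (wker P w w)) (wker_cvg P w w); rewrite subrr.
apply: cvgC_near; exists 0%N => N _.
by rewrite (wker_tail P N) addrAC subrr add0r.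
Qed.

Lemma wker_pred1 v z w : wker (pred1 v) z w = mono v z * (mono v w)^*.
Proof.
rewrite (wker_finite (N := (size v).+1)) => [|u /eqP ->//].
rewrite big_ord_recr /= big1 ?add0r => [|m _].
  rewrite /wker_deg -big_filter (@filter_pred1_uniq _ _ v) ?words_uniq ?mem_words //.
  by rewrite big_seq1.
rewrite /wker_deg big_seq_cond big1 // => u /andP[]; rewrite mem_words => /eqP us /eqP uv.
by move: (ltn_ord m); rewrite -us uv ltnn.
Qed.

End WordKernels.

(** * Comparison of kernels *)
Section Domination.
Variable R : realType.

(** With [c = G w w], the kernel [c K - G_w G_w^*] is the sum of [c (K - G)] and
    of the kernel of [psd_cauchy_schwarz]; conclude by [rk_membership]. *)
Lemma rk_dominated_kernel (X : Type) (K G : X -> X -> R[i]) (H : rkhs K) w :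
  psd G -> psd (fun x y => K x y - G x y) ->
  rk_set H (G^~ w) /\ hnorm H (G^~ w) ^+ 2 <= complex.Re (G w w).
Proof.
move=> pG pKG; have gw := psd_diag w pG.
have gw0 : 0 <= complex.Re (G w w) by rewrite -lecR RRe_real // ger0_real.
have C2 : (Num.sqrt (complex.Re (G w w)) ^+ 2)%:C%C = G w w.
  by rewrite sqr_sqrtr // RRe_real // ger0_real.
have := @rk_membership _ _ _ H (G^~ w) _ (sqrtr_ge0 (complex.Re (G w w))); rewrite C2.
case=> [|hG [nG _]].
  have := psdD (psdZ gw pKG) (psd_cauchy_schwarz w pG); congr psd.
  by apply/funext => x; apply/funext => y; ring.
by split => //; rewrite -ler_sqrt // sqrtr_sqr ger0_norm // hnorm_ge0.
Qed.

Lemma rk_composition (X Y : Type) (K : X -> X -> R[i]) (L : Y -> Y -> R[i])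
    (H : rkhs K) (G : rkhs L) (s : Y -> X) f :
  psd (fun y y' => L y y' - K (s y) (s y')) -> rk_set H f ->
  rk_set G (f \o s) /\ hnorm G (f \o s) <= hnorm H f.
Proof.
move=> pLK hf.
have h : psd (fun y y' => (hnorm H f ^+ 2)%:C%C * L y y' - (f \o s) y * ((f \o s) y')^*).
  have f0 : 0 <= (hnorm H f ^+ 2)%:C%C :> R[i] by rewrite ler0c sqr_ge0.
  have := psdD (psdZ f0 pLK) (psd_pull s (rk_psd_sub hf)); congr psd.
  by apply/funext => y; apply/funext => y' /=; ring.
by have [? []] := @rk_membership _ _ _ G _ _ (hnorm_ge0 H f) h.
Qed.

End Domination.

(** * Monomials in the Drury-Arveson space *)
Section DruryArveson.
Variables (R : realType) (d : nat) (H : rkhs (@DA_kernel R d)).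
Local Notation ball := (unit_ball R d).
Local Notation dot := (rk_dot H).
Local Notation mem := (rk_set H).
Local Notation nrm := (hnorm H).
Implicit Types (z w : ball) (u v : seq 'I_d) (P : pred (seq 'I_d)) (m n : nat).

Lemma psd_sub_wker P : psd (fun z w => DA_kernel z w - wker P z w).
Proof.
have := @psd_wker R d (fun u => ~~ P u); congr psd.
by apply/funext => z; apply/funext => w; rewrite (wkerC P) addrAC subrr add0r.
Qed.

Lemma wker_mem P w : mem (wker P ^~ w).
Proof. by have [] := rk_dominated_kernel H w (psd_wker P) (@psd_sub_wker P). Qed.

Lemma wker_hnorm P w : nrm (wker P ^~ w) ^+ 2 <= complex.Re (wker P w w).
Proof. by have [] := rk_dominated_kernel H w (psd_wker P) (@psd_sub_wker P). Qed.

Lemma mono_mem u : mem (@mono R d u).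
Proof.
have := @rk_membership _ _ _ H (@mono R d u) 1 ler01; case=> //.
have := psd_sub_wker (pred1 u); congr psd; apply/funext => z; apply/funext => w.
by rewrite expr1n rmorph1 mul1r wker_pred1.
Qed.

(** The series of [wker P ^~ w] converges in norm, because the squared norm of
    its tail is at most the value of the tail at [w], by [wker_hnorm]. *)
Lemma dot_wker f P w : mem f ->
  cvgC (fun n => \sum_(m < n) \sum_(u <- words 'I_d m | P u) mono u w * dot f (@mono R d u))
    (dot f (wker P ^~ w)).
Proof.
move=> hf; pose tail N := wker (fun u => P u && (N <= size u)%N) ^~ w.
have deg_mem m : mem (wker_deg P m ^~ w).
  apply: rk_set_sum => u _; under eq_fun do rewrite mulrC.
  by apply: rk_setZ; exact: mono_mem.
have dot_deg m : dot f (wker_deg P m ^~ w) =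
    \sum_(u <- words 'I_d m | P u) mono u w * dot f (@mono R d u).
  rewrite dot_sumr // => [|u _]; last first.
    by under eq_fun do rewrite mulrC; apply: rk_setZ; exact: mono_mem.
  apply: eq_bigr => u _; under eq_fun do rewrite mulrC.
  by rewrite dotZr ?conjCK //; exact: mono_mem.
have tail0 : cvgC (fun N => dot f (tail N)) 0.
  have /cvgC_norm := wker_tail_cvg P w; rewrite cabs0 => h.
  have hs := @cvg_comp _ _ _ _ Num.sqrt _ _ _ h (@sqrt_continuous R 0).
  rewrite sqrtr0 in hs.
  have := cvgM (@cvg_cst _ (nrm f) _ \oo _) hs; rewrite mulr0 => {}hs.
  apply: (@cvgC_squeeze _ _ _ (fun N => nrm f * Num.sqrt (cabs
    (wker (fun u => P u && (N <= size u)%N) w w)))); last exact: hs.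
  move=> N; rewrite subr0.
  apply: le_trans (cauchy_schwarz hf (wker_mem _ w)) _.
  rewrite ler_wpM2l ?hnorm_ge0 //= -(ger0_norm (hnorm_ge0 H (tail N))) -sqrtr_sqr.
  rewrite ler_wsqrtr //; apply: le_trans (wker_hnorm _ _) _.
  exact: le_trans (ler_norm _) (Re_le_cabs _).
have := cvgCB (cvgC_cst (dot f (wker P ^~ w))) tail0; rewrite subr0.
apply: cvgC_near; exists 0%N => N _.
have -> : wker P ^~ w = (fun z => \sum_(m < N) wker_deg P m z w) \+ tail N.
  by apply/funext => z; exact: wker_tail.
have hsum : mem (fun z => \sum_(m < N) wker_deg P m z w) by exact: rk_set_sum.
rewrite dotDr //; last exact: wker_mem.
rewrite addrK dot_sumr //; apply: eq_bigr => m _.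
exact: dot_deg.
Qed.

Lemma dot_wker0 f P w : mem f -> (forall u, P u -> dot f (@mono R d u) = 0) ->
  dot f (wker P ^~ w) = 0.
Proof.
move=> hf fP; apply: cvgC_unique (dot_wker P w hf) _.
apply: cvgC_near (cvgC_cst _); exists 0%N => n _.
by rewrite big1 // => m _; rewrite big1 // => u /fP ->; rewrite mulr0.
Qed.

Lemma rotate_subproof (i : 'I_d) (c : R[i]) (c1 : `|c| = 1) z :
  \sum_j `|(\row_j (if j == i then c * val z 0 j else val z 0 j)) 0 j| ^+ 2 < 1.
Proof.
case: z => z /=; congr (_ < _); apply: eq_bigr => j _; rewrite mxE.
by case: ifP => // _; rewrite normrM c1 mul1r.
Qed.

Definition rotate (i : 'I_d) (c : R[i]) (c1 : `|c| = 1) z : ball :=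
  exist (fun x : 'rV[R[i]]_d => is_true (\sum_i `|x 0 i| ^+ 2 < 1)) _ (rotate_subproof i c1 z).

Lemma rotate_kernel i c (c1 : `|c| = 1) z w :
  DA_kernel (rotate i c1 z) (rotate i c1 w) = DA_kernel z w.
Proof.
rewrite /DA_kernel; congr (1 - _)^-1; apply: eq_bigr => j _; rewrite /= !mxE.
case: ifP => // _; rewrite rmorphM /= mulrACA -normCK c1 expr1n mul1r.
by [].
Qed.

Lemma mono_rotate i c (c1 : `|c| = 1) u z :
  mono u (rotate i c1 z) = c ^+ count_mem i u * mono u z.
Proof.
rewrite /mono; elim: u => [|j u ih]; first by rewrite !big_nil expr0 mul1r.
rewrite !big_cons ih /= mxE eq_sym; case: eqP => [->|_].
  by rewrite exprS; ring.
by rewrite add0n mulrCA.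
Qed.

(** Choose a coordinate whose degrees in the two monomials differ, and rotate it
    by an angle for which the two monomials are multiplied by opposite factors.
    Rotation is a contraction, so [mono u - t * mono v] is not longer than
    [mono u + t * mono v], for every [t]. *)
Lemma mono_orthogonal u v : ~~ perm_eq u v -> dot (@mono R d u) (@mono R d v) = 0.
Proof.
move=> uv.
have [j] : exists j, count_mem j u != count_mem j v.
  apply/existsP; apply: contraNT uv; rewrite negb_exists => /forallP h.
  by apply/allP => i _ /=; have := h i; rewrite negbK.
wlog: u v {uv} / (count_mem j u < count_mem j v)%N.
  move=> h; rewrite neq_ltn => /orP[lt|lt]; first by rewrite h // neq_ltn lt.
  rewrite (rk_dotC (mono_mem v) (mono_mem u)) h ?conjC0 //.
  by rewrite neq_ltn lt.
move=> lt _; pose k := (count_mem j v - count_mem j u)%N.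
have k0 : (0 < k)%N by rewrite subn_gt0.
pose c : R[i] := k.-root (-1).
have ck : c ^+ k = -1 by rewrite rootCK.
have c1 : `|c| = 1.
  by apply/eqP; rewrite -(@pexpr_eq1 _ _ k) // -normrX ck normrN1.
have cv : c ^+ count_mem j v = - c ^+ count_mem j u.
  by rewrite -(subnK (ltnW lt)) exprD -/k ck mulN1r.
have hu := mono_mem u; have hv := mono_mem v.
have pos (t : R[i]) : 0 <= complex.Re (t^* * dot (@mono R d u) (@mono R d v)).
  have htv := rk_setZ t hv.
  have [] := @rk_composition _ _ _ _ _ H H (rotate j c1) _ _ (rk_setD hu htv).
    move=> s; rewrite /kform big1 // => p _; rewrite big1 // => q _.
    by rewrite rotate_kernel subrr mulr0.
  have -> : (@mono R d u \+ (fun z => t * mono v z)) \o rotate j c1 =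
      fun z => c ^+ count_mem j u * (@mono R d u \- (fun z => t * mono v z)) z.
    by apply/funext => z; rewrite /= !mono_rotate cv; ring.
  have hB := rk_setB hu htv.
  move=> _; rewrite hnormZ //.
  have -> : cabs (c ^+ count_mem j u) = 1 by rewrite /cabs normrX c1 expr1n.
  rewrite mul1r -(@ler_pXn2r _ 2) ?nnegrE ?hnorm_ge0 //.
  rewrite hnormB_sqr // hnormD_sqr // dotZr //; lra.
have := pos (- dot (@mono R d u) (@mono R d v)).
rewrite rmorphN /= mulNr mulrC -cabs_sqr => h; apply: cabs_eq0.
have /= := h; rewrite oppr_ge0 => h2.
by apply/eqP; rewrite -sqrf_eq0 eq_le h2 sqr_ge0.
Qed.

End DruryArveson.

(** * Balanced words and the kernel on the disc *)
Section BalancedWords.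
Variables (R : realType) (d : nat) (hd : (0 < d)%N) (H : rkhs (@DA_kernel R d)).
Local Notation ball := (unit_ball R d).
Local Notation dot := (rk_dot H).
Local Notation mem := (rk_set H).
Local Notation nrm := (hnorm H).
Implicit Types (z w : ball) (u v : seq 'I_d) (k m n : nat).

(** Multiplied by [d], so that the condition is additive under concatenation. *)
Definition balanced u : bool := [forall j : 'I_d, d * count_mem j u == size u]%N.

Definition diag_word k : seq 'I_d := flatten (nseq k (enum 'I_d)).

Lemma count_diag_word j k : count_mem j (diag_word k) = k.
Proof.
elim: k => //= k ih; rewrite count_cat -/(diag_word k) ih.
by rewrite count_uniq_mem ?enum_uniq // mem_enum.
Qed.

Lemma size_diag_word k : size (diag_word k) = (d * k)%N.
Proof.
elim: k => [|k ih]; first by rewrite muln0.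
by rewrite /= size_cat -/(diag_word k) ih size_enum_ord mulnS.
Qed.

Lemma balanced_perm u k :
  balanced u && (size u == d * k)%N = perm_eq u (diag_word k).
Proof.
apply/andP/idP => [[/forallP bu /eqP su]|].
  apply/allP => j _ /=; rewrite count_diag_word.
  by rewrite -(eqn_pmul2l hd) -su bu.
move=> hp; have su := perm_size hp; rewrite size_diag_word in su.
split; last by rewrite su.
apply/forallP => j; rewrite su.
by move/permP: hp => ->; rewrite count_diag_word.
Qed.

Lemma mono_diag_word k z : mono (diag_word k) z = (\prod_j val z 0 j) ^+ k.
Proof.
rewrite /mono; elim: k => [|k ih]; first by rewrite big_nil expr0.
by rewrite big_cat -/(diag_word k) ih exprS big_enum.
Qed.

Lemma mono_perm u v z : perm_eq u v -> mono u z = mono v z.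
Proof. exact: perm_big. Qed.

Definition balanced_count k : nat := count balanced (words 'I_d (d * k)).

Lemma wker_deg_perm k z w :
  wker_deg (fun u => perm_eq u (diag_word k)) (d * k) z w =
  (balanced_count k)%:R * (mono (diag_word k) z * (mono (diag_word k) w)^*).
Proof.
rewrite /wker_deg (eq_bigr (fun=> mono (diag_word k) z * (mono (diag_word k) w)^*)); last first.
  by move=> u uk; rewrite !(mono_perm _ uk).
rewrite big_const_seq iter_addr_0 mulr_natl; congr (_ *+ _).
apply: eq_in_count => u; rewrite mem_words => /eqP su.
by rewrite -balanced_perm su eqxx andbT.
Qed.

Lemma wker_deg_balanced k z w : wker_deg balanced (d * k) z w =
  (balanced_count k)%:R * (mono (diag_word k) z * (mono (diag_word k) w)^*).
Proof.
rewrite -wker_deg_perm; apply: eq_wker_deg => u su.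
by rewrite -balanced_perm su eqxx andbT.
Qed.

Lemma wker_deg_balanced0 m z w : ~~ (d %| m)%N -> wker_deg balanced m z w = 0.
Proof.
move=> dm; rewrite /wker_deg big_seq_cond big1 // => u /andP[].
rewrite mem_words => /eqP su /forallP /(_ (Ordinal hd)) /eqP h.
by move: dm; rewrite -su -h dvdn_mulr.
Qed.

Lemma wker_deg_balanced_series n z w :
  \sum_(m < d * n) wker_deg balanced m z w = \sum_(k < n) wker_deg balanced (d * k) z w.
Proof.
elim: n => [|n ih]; first by rewrite muln0 !big_ord0.
rewrite big_ord_recr -ih /= mulnS addnC big_split_ord /=; congr (_ + _).
rewrite (bigD1 (Ordinal hd)) //= addn0 big1 ?addr0 // => j j0.
apply: wker_deg_balanced0; rewrite dvdn_addr ?dvdn_mulr //; apply/negP.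
move=> /(dvdn_leq); rewrite lt0n => /(_ j0).
by rewrite leqNgt ltn_ord.
Qed.

Lemma wker_perm k z w : wker (fun u => perm_eq u (diag_word k)) z w =
  (balanced_count k)%:R * (mono (diag_word k) z * (mono (diag_word k) w)^*).
Proof.
rewrite (wker_finite (N := (d * k).+1)) => [|u /perm_size ->]; last by rewrite size_diag_word.
rewrite big_ord_recr /= wker_deg_perm big1 ?add0r // => m _.
rewrite /wker_deg big_seq_cond big1 // => u /andP[]; rewrite mem_words => /eqP us /perm_size.
by rewrite us size_diag_word => mk; move: (ltn_ord m); rewrite mk ltnn.
Qed.

Lemma diag_point_subproof :
  \sum_j `|(const_mx ((d.+1%:R)^-1) : 'rV[R[i]]_d) 0 j| ^+ 2 < 1.
Proof.
have h : 0 < d.+1%:R :> R[i] by rewrite ltr0n.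
under eq_bigr do rewrite mxE ger0_norm ?invr_ge0 ?ler0n //.
rewrite sumr_const card_ord -[_ *+ d]mulr_natl.
apply: (@le_lt_trans _ _ (d%:R / d.+1%:R)); last by rewrite ltr_pdivrMr // mul1r ltr_nat.
rewrite expr2 ler_wpM2l ?ler0n // ger_pMl ?invr_gt0 //.
by rewrite invf_le1 // ler1n.
Qed.

(** A point of the ball with nonzero coordinates. *)
Definition diag_point : ball :=
  exist (fun x : 'rV[R[i]]_d => is_true (\sum_i `|x 0 i| ^+ 2 < 1)) _ diag_point_subproof.

(** Pair the monomial with the kernel function at a point: only the words with
    the same content contribute, and each of them contributes the squared norm
    of the monomial times its value at the point. *)
Lemma mono_hnorm k : (balanced_count k)%:R * nrm (@mono R d (diag_word k)) ^+ 2 = 1.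
Proof.
set f := @mono R d _; have hf : mem f by exact: mono_mem.
pose P u := perm_eq u (diag_word k).
pose w := diag_point.
have fw : f w != 0.
  rewrite /f mono_diag_word expf_neq0 // prodf_seq_neq0; apply/allP => j _ /=.
  by rewrite mxE invr_neq0 // pnatr_eq0.
have := rk_reproducing w hf.
have -> : (@DA_kernel R d)^~ w = wker P ^~ w \+ wker (fun u => ~~ P u) ^~ w.
  by apply/funext => z; exact: wkerC.
rewrite dotDr //; try exact: wker_mem.
rewrite (dot_wker0 _ (P := fun u => ~~ P u)) // => [|u]; last first.
  by rewrite /P perm_sym => /(mono_orthogonal H).
have -> : wker P ^~ w = fun z => ((balanced_count k)%:R * (f w)^*) * f z.
  by apply/funext => z; rewrite wker_perm -/f mulrAC mulrA.
rewrite addr0 dotZr // rmorphM /= conjCK rmorph_nat dot_hnorm // => h.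
apply: complexI; apply: (mulIf fw); rewrite rmorph1 mul1r -[RHS]h.
by rewrite rmorphM /= rmorph_nat mulrAC.
Qed.

Let scale : R := (d%:R : R) `^ (d%:R / 2).

Let scale_gt0 : 0 < scale.
Proof. by rewrite powR_gt0 // ltr0n. Qed.

Lemma tau_coefE k : tau_coef H k = (balanced_count k)%:R / scale ^+ (k + k).
Proof.
rewrite /tau_coef.
have -> : (fun z : ball => tau (val z) ^+ k) =
    fun z => (scale ^+ k)%:C%C * mono (diag_word k) z.
  by apply/funext => z; rewrite /tau exprMn mono_diag_word rmorphXn.
rewrite hnormZ ?cabs_real; last exact: mono_mem.
have sk : 0 < scale ^+ k by rewrite exprn_gt0.
rewrite ger0_norm ?ltW // exprMn invfM exprD -expr2 mulrC; congr (_ * _).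
have := mono_hnorm k; set x := nrm _ ^+ 2 => h.
have x0 : x != 0 by apply/eqP => x0; move: h; rewrite x0 mulr0 => /esym/eqP; rewrite oner_eq0.
by apply: (mulIf x0); rewrite mulVf.
Qed.

Lemma tau_kernel_pull z w :
  tau_kernel H (tau_ball hd z) (tau_ball hd w) = wker balanced z w.
Proof.
apply: cvgC_lim.
have := cvgC_subseq (phi := fun n => (d * n)%N) _ (wker_cvg balanced z w).
move=> /(_ (fun n => leq_pmull n hd)); apply: cvgC_near; exists 0%N => n _.
rewrite /= wker_deg_balanced_series /series /= big_mkord; apply: eq_bigr => k _.
rewrite wker_deg_balanced tau_coefE /tau !mono_diag_word -/scale rmorphXn /=.
rewrite (rmorphM Num.conj) /= conj_realC !exprMn.
set a := (\prod_j val z 0 j) ^+ k; set b := (_ ^* ^+ k).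
have S0 : scale%:C%C ^+ k != 0 :> R[i] by rewrite expf_neq0 // fmorph_eq0 gt_eqF.
have -> : ((balanced_count k)%:R / scale ^+ (k + k))%:C%C =
    (balanced_count k)%:R * (scale%:C%C ^+ k)^-1 * (scale%:C%C ^+ k)^-1 :> R[i].
  by rewrite exprD invfM mulrA !rmorphM /= rmorph_nat fmorphV rmorphXn.
by move: S0; set S := _ ^+ k => S0; field.
Qed.

(** The kernel of the balanced words is reproducing on its own kernel functions,
    as these are orthogonal to the monomials of all other words. *)
Lemma wker_balanced_dot (v w : ball) :
  dot (wker balanced ^~ w) (wker balanced ^~ v) = wker balanced v w.
Proof.
set f := wker balanced ^~ w; have hf : mem f by exact: wker_mem.
have -> : wker balanced v w = dot f (@DA_kernel R d ^~ v) by rewrite rk_reproducing.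
have -> : (@DA_kernel R d)^~ v =
    wker balanced ^~ v \+ wker (fun u => ~~ balanced u) ^~ v.
  by apply/funext => z; exact: wkerC.
rewrite [RHS]dotDr //; try exact: wker_mem.
rewrite [X in _ = _ + X]dot_wker0 ?addr0 // => u bu.
rewrite (rk_dotC (mono_mem H u) hf) dot_wker0 ?conjC0 //; first exact: mono_mem.
move=> u' bu'; apply: mono_orthogonal; apply: contra bu => uu'.
apply/forallP => j; rewrite (perm_size uu'); move/permP: uu' => ->.
by move/forallP: bu'.
Qed.

End BalancedWords.

Arguments balanced {d} u.

(** * Longest balanced prefixes *)
Section Factorization.
Variables (R : realType) (d : nat).
Implicit Types (z w : unit_ball R d) (u v : seq 'I_d) (m n : nat).

Definition balance_free v : bool := all (fun k => ~~ balanced (take k v)) (iota 1 (size v)).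

Lemma balanced_cat u v : balanced u -> balanced (u ++ v) = balanced v.
Proof.
move=> /forallP bu; rewrite /balanced; apply: eq_forallb => j.
by rewrite count_cat size_cat mulnDr (eqP (bu j)) eqn_add2l.
Qed.

Lemma balance_freeP v k : balance_free v -> (0 < k <= size v)%N -> ~~ balanced (take k v).
Proof. by move=> /allP h k0; apply: h; rewrite mem_iota add1n ltnS. Qed.

(** The one position that contributes is the end of the longest balanced prefix:
    after a shorter balanced prefix, the rest of the longest one is a balanced
    prefix of what remains. *)
Lemma sum_longest_balanced_prefix (V : nmodType) (x : V) u :
  \sum_(k < (size u).+1)
    (if balanced (take k u) && balance_free (drop k u) then x else 0) = x.
Proof.
pose P k := (k <= size u)%N && balanced (take k u).
have P0 : exists k, P k.
  by exists 0%N; rewrite /P take0 /=; apply/forallP => j; rewrite muln0.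
have Pub k : P k -> (k <= size u)%N by case/andP.
case: (ex_maxnP P0 Pub) => k0 /andP[k0u bk0] k0max.
have k0S : (k0 < (size u).+1)%N by rewrite ltnS.
rewrite (bigD1 (Ordinal k0S)) //= bk0 /= ifT; last first.
  apply/allP => k; rewrite mem_iota add1n ltnS size_drop => /andP[k_gt0 ku].
  apply/negP => bk; have : P (k0 + k)%N.
    by rewrite /P takeD balanced_cat // bk andbT; lia.
  by move/k0max; rewrite leqNgt -[X in (X < _)%N]addn0 ltn_add2l k_gt0.
rewrite big1 ?addr0 // => k kk0; rewrite ifF //; apply/negP => /andP[bk fk].
have ku : (k <= size u)%N by rewrite -ltnS.
have lek : (k <= k0)%N by apply: k0max; rewrite /P ku bk.
have ltk : (k < k0)%N.
  by rewrite ltn_neqAle lek andbT; apply: contraNneq kk0 => kk0; apply/eqP/val_inj.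
have := balance_freeP (k := k0 - k) fk; rewrite subn_gt0 ltk size_drop leq_sub2r //.
move=> /(_ isT) /negP; apply; move: bk0.
by rewrite -{1}(subnKC lek) takeD balanced_cat.
Qed.

Lemma sum_words_factor (V : nmodType) (G : seq 'I_d -> V) m :
  \sum_(u <- words 'I_d m) G u =
  \sum_(k < m.+1) \sum_(u <- words 'I_d k | balanced u)
     \sum_(v <- words 'I_d (m - k) | balance_free v) G (u ++ v).
Proof.
transitivity (\sum_(k < m.+1) \sum_(u <- words 'I_d m)
    (if balanced (take k u) && balance_free (drop k u) then G u else 0)).
  rewrite exchange_big /= big_seq [RHS]big_seq; apply: eq_bigr => u.
  by rewrite mem_words => /eqP <-; rewrite sum_longest_balanced_prefix.
apply: eq_bigr => k _; have km : (k <= m)%N by rewrite -ltnS.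
rewrite -{1}(subnKC km) sum_words_cat [RHS]big_mkcond big_seq [RHS]big_seq.
apply: eq_bigr => u; rewrite mem_words => /eqP su.
under eq_bigr do rewrite -su take_size_cat // drop_size_cat //.
case: (balanced u) => /=; last by rewrite big1.
by rewrite [RHS]big_mkcond.
Qed.

Lemma mono_cat u v z : mono (u ++ v) z = mono u z * mono v z.
Proof. exact: big_cat. Qed.

Lemma wker_deg_factor m z w : wker_deg predT m z w =
  \sum_(k < m.+1) wker_deg balanced k z w * wker_deg balance_free (m - k) z w.
Proof.
rewrite /wker_deg sum_words_factor; apply: eq_bigr => k _.
rewrite mulr_suml; apply: eq_bigr => u _; rewrite mulr_sumr; apply: eq_bigr => v _.
by rewrite !mono_cat (rmorphM Num.conj) /= mulrACA.
Qed.

Lemma DA_factor z w : DA_kernel z w = wker balanced z w * wker balance_free z w.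
Proof.
rewrite -wker_predT; apply: cvgC_unique (wker_cvg predT z w) _.
have := cvgC_cauchy_product (radius_bound z w)
  (fun m => wker_deg_bound balanced m z w) (fun m => wker_deg_bound balance_free m z w)
  (wker_cvg _ _ _) (wker_cvg _ _ _).
by apply: cvgC_near; exists 0%N => n _; apply: eq_bigr => m _; rewrite wker_deg_factor.
Qed.

Lemma psd_mul_wker (X : Type) (K : X -> X -> R[i]) (s : X -> unit_ball R d)
    (P : pred (seq 'I_d)) :
  psd K -> psd (fun x y => K x y * wker P (s x) (s y)).
Proof.
move=> pK.
apply: (@psd_lim _ _ (fun n x y => \sum_(m < n) K x y * wker_deg P m (s x) (s y))) => [n|x y].
  apply: psd_sum => m _.
  have := @psd_sum _ _ _ (words 'I_d m) P
    (fun u x y => K x y * (mono u (s x) * (mono u (s y))^*)).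
  have -> : (fun x y => \sum_(u <- words 'I_d m | P u)
        K x y * (mono u (s x) * (mono u (s y))^*)) =
      fun x y => K x y * wker_deg P m (s x) (s y).
    by apply/funext => x; apply/funext => y; rewrite mulr_sumr.
  by apply=> u _; exact: (psd_mul_gram (fun x => mono u (s x)) pK).
have := cvgCZ (K x y) (wker_cvg P (s x) (s y)).
by apply: cvgC_near; exists 0%N => n _; rewrite mulr_sumr.
Qed.

End Factorization.

Arguments balance_free {d} v.

(** * Composition with tau is isometric *)
Section Pullback.
Variables (R : realType) (d : nat) (hd : (0 < d)%N).
Variables (H : rkhs (@DA_kernel R d)) (G : rkhs (tau_kernel H)).

(** On the points with equal coordinates [tau] is a rescaled [d]-th power. *)
Lemma tau_ball_onto (x : unit_disc R) : exists z : unit_ball R d, tau_ball hd z = x.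
Proof.
case: x => x x1.
pose s : R := (d%:R : R) `^ 2^-1.
have s0 : 0 < s by rewrite powR_gt0 // ltr0n.
have s2 : s ^+ 2 = d%:R by rewrite -powR_mulrn ?ltW // -powRrM mulVf // powRr1.
have sC2 : s%:C%C ^+ 2 = d%:R :> R[i].
  by rewrite -(rmorphXn (real_complex R)) /= s2 rmorph_nat.
have ns : `|s%:C%C : R[i]| = s%:C%C by rewrite normr_cabs cabs_real ger0_norm // ltW.
pose c : R[i] := d.-root x.
have cd : c ^+ d = x by rewrite rootCK.
have c1 : `|c| < 1 by rewrite -(@expr_lt1 _ d) // -normrX cd.
have hz : \sum_i `|(const_mx (s%:C%C^-1 * c) : 'rV[R[i]]_d) 0 i| ^+ 2 < 1.
  under eq_bigr do rewrite mxE.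
  rewrite sumr_const card_ord normrM exprMn normfV ns exprVn.
  rewrite sC2 -mulrnAl -[_^-1 *+ d]mulr_natl divff ?mul1r.
    by rewrite expr_lt1.
  by rewrite pnatr_eq0 -lt0n.
exists (exist (fun z : 'rV[R[i]]_d => is_true (\sum_i `|z 0 i| ^+ 2 < 1)) _ hz).
apply: val_inj; rewrite /= /tau.
under eq_bigr do rewrite mxE.
rewrite prodr_const card_ord exprMn cd exprVn -rmorphXn.
have -> : (d%:R : R) `^ (d%:R / 2) = s ^+ d.
  by rewrite -powR_mulrn ?ltW // -powRrM mulrC.
by rewrite mulrA divff ?mul1r // fmorph_eq0 expf_neq0 // gt_eqF.
Qed.

(** By surjectivity of [tau] every kernel function on the disc pulls back to the
    balanced kernel function at some point of the ball, and the inner products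
    agree by [wker_balanced_dot]. *)
Lemma pullback_comb s : hnorm H (kernel_comb (tau_kernel H) s \o tau_ball hd) =
  hnorm G (kernel_comb (tau_kernel H) s).
Proof.
apply/eqP; rewrite -(@eqrXn2 _ 2) ?hnorm_ge0 //; apply/eqP/complexI.
pose zz x := projT1 (cid (tau_ball_onto x)).
have zzK x : tau_ball hd (zz x) = x by rewrite /zz; case: cid.
rewrite hnorm_kernel_comb.
have -> : kernel_comb (tau_kernel H) s \o tau_ball hd =
    fun z => \sum_(p <- s) p.1 * wker balanced z (zz p.2).
  apply/funext => z; apply: eq_bigr => p _.
  by rewrite -(tau_kernel_pull hd H) zzK.
have hm p : rk_set H (fun z => p.1 * wker balanced z (zz p.2)).
  by apply: rk_setZ; exact: wker_mem.
rewrite -dot_hnorm; last exact: rk_set_sum.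
rewrite dot_sumr //; last exact: rk_set_sum.
apply: eq_bigr => p _; rewrite dot_suml //; apply: eq_bigr => q _.
rewrite (dotZl _ (wker_mem H _ _) (hm p)) (dotZr _ (wker_mem H _ _) (wker_mem H _ _)).
by rewrite wker_balanced_dot -(tau_kernel_pull hd H) !zzK mulrCA mulrA.
Qed.

(** Composition is a contraction because [DA] dominates the pulled back kernel.
    It preserves the norms of kernel combinations, which are dense. *)
Lemma pullback_isometry f : rk_set G f ->
  rk_set H (f \o tau_ball hd) /\ hnorm H (f \o tau_ball hd) = hnorm G f.
Proof.
have psdH : psd (fun z w => DA_kernel z w - tau_kernel H (tau_ball hd z) (tau_ball hd w)).
  have := @psd_sub_wker R d balanced; congr psd.
  by apply/funext => z; apply/funext => w; rewrite tau_kernel_pull.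
have le g (hg : rk_set G g) := rk_composition H psdH hg.
move=> hf; have [hft nft] := le f hf; split => //.
apply/eqP; rewrite eq_le nft /=.
have [_ [_ [v vf]]] := rk_membership G (hnorm_ge0 G f) (rk_psd_sub hf).
have lim : (fun n => hnorm H (f \o tau_ball hd) +
    hnorm G (kernel_comb (tau_kernel H) (v n) \- f) *+ 2) @ \oo --> hnorm H (f \o tau_ball hd).
  rewrite -[X in _ --> X]addr0 -(mul0rn _ 2); apply: cvgD; first exact: cvg_cst.
  exact: cvgMn.
apply: (cvgr_to_ge lim); apply: nearW => n.
have hc := kernel_comb_mem G (v n).
have h1 := hnormB hf hc; rewrite hnormBC // in h1.
have [hct _] := le _ hc; have [_ hd2] := le _ (rk_setB hc hf).
have h2 := hnormB hct hft; rewrite pullback_comb in h2.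
have := le_trans h1 (lerD h2 (lexx _)); move=> h3; apply: le_trans h3 _.
rewrite -addrA lerD2l mulr2n lerD2r; exact: hd2.
Qed.

End Pullback.

(** * Operator norms of matrices of multipliers *)
Section OperatorNorm.
Variables (R : realType) (X : Type) (K : X -> X -> R[i]) (H : rkhs K).
Variables (r : nat) (F : 'M[X -> R[i]]_r).
Local Notation Hr := (dsum H r).

Lemma mx_mul_mem f : (forall i j, Mult H (F i j)) -> rk_set Hr f -> rk_set Hr (mx_mul F f).
Proof. by move=> multF hf i; apply: rk_set_sum => j _; apply: (multF i j); exact: hf. Qed.

Lemma curry_mx_apply f : curry_fam (mx_apply F f) = mx_mul F (curry_fam f).
Proof. by []. Qed.

Lemma mult_norm_le (M : R) : 0 <= M ->
  (forall f, rk_set Hr f -> rk_set Hr (mx_mul F f) /\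
     hnorm Hr (mx_mul F f) <= M * hnorm Hr f) ->
  (mult_norm H F <= M%:E)%E.
Proof.
move=> M0 FM; apply: ge_ereal_sup => _ [f [hf f1] <-].
have [hFf Ff] := FM (curry_fam f) hf.
rewrite lee_fin hpow_normE // curry_mx_apply; apply: le_trans Ff _.
by rewrite -hpow_normE // ler_piMr.
Qed.

Lemma mult_norm_ge f : hpow H f -> hpow_norm H f <= 1 ->
  ((hpow_norm H (mx_apply F f))%:E <= mult_norm H F)%E.
Proof. by move=> hf f1; apply: ereal_sup_ubound; exists f. Qed.

Lemma mult_norm_bound (M : R) : (forall i j, Mult H (F i j)) ->
  (mult_norm H F <= M%:E)%E ->
  forall f, rk_set Hr f -> rk_set Hr (mx_mul F f) /\
     hnorm Hr (mx_mul F f) <= M * hnorm Hr f.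
Proof.
move=> multF FM f hf; have hFf := mx_mul_mem multF hf; split => //.
have unit_bound g : rk_set Hr g -> hnorm Hr g <= 1 -> hnorm Hr (mx_mul F g) <= M.
  move=> hg g1; pose g' i x := g (i, x).
  have gE : curry_fam g' = g by apply/funext => -[].
  have hg' : hpow H g' by [].
  have := mult_norm_ge (f := g') hg'; rewrite !hpow_normE //; last first.
    by move=> i; have := mx_mul_mem multF hg i.
  rewrite curry_mx_apply gE => /(_ g1) h.
  by rewrite -lee_fin; exact: le_trans h FM.
have := hnorm_ge0 Hr f; rewrite le_eqVlt => /orP[/eqP f0|f0].
  have fE := hnorm_eq0 hf (esym f0).
  rewrite -f0 mulr0 fE (_ : mx_mul F _ = fun=> 0) ?hnorm0 //.
  by apply/funext => p; rewrite /mx_mul big1 // => j _; rewrite mulr0.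
pose c : R[i] := ((hnorm Hr f)^-1)%:C%C.
have cc : cabs c = (hnorm Hr f)^-1 by rewrite cabs_real ger0_norm // invr_ge0 ltW.
have := unit_bound _ (rk_setZ c hf).
rewrite hnormZ // cc mulVf ?gt_eqF // lexx => /(_ isT).
rewrite (_ : mx_mul F _ = fun p => c * mx_mul F f p); last first.
  apply/funext => p; rewrite /mx_mul mulr_sumr.
  by apply: eq_bigr => j _; rewrite mulrCA.
by rewrite hnormZ // cc mulrC ler_pdivrMr.
Qed.

Lemma mult_norm_ge0 : (0%:E <= mult_norm H F)%E.
Proof.
have h0 : hpow H (fun (i : 'I_r) (x : X) => 0) by move=> i; exact: rk_set0.
have n0 : hpow_norm H (fun (i : 'I_r) (x : X) => 0) = 0.
  by rewrite hpow_normE // (hnorm0 Hr).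
apply: le_trans (mult_norm_ge h0 _); last by rewrite n0 ler01.
by rewrite lee_fin sqrtr_ge0.
Qed.

End OperatorNorm.

(** * Transfer of multipliers from the disc to the ball *)
Section Transfer.
Variables (R : realType) (d : nat) (hd : (0 < d)%N).
Variables (H : rkhs (@DA_kernel R d)) (G : rkhs (tau_kernel H)).
Local Notation pull := (tau_pullback hd).

(** Pull the positive kernel of the disc back along [tau] and multiply it with
    the kernel of the balance-free words: by [DA_factor] the result is the
    positive kernel for the ball. *)
Lemma bound_transfer r (F : 'M[unit_disc R -> R[i]]_r) (M : R) : 0 <= M ->
  (forall f, rk_set (dsum G r) f -> rk_set (dsum G r) (mx_mul F f) /\
     hnorm (dsum G r) (mx_mul F f) <= M * hnorm (dsum G r) f) ->
  forall f, rk_set (dsum H r) f -> rk_set (dsum H r) (mx_mul (map_mx pull F) f) /\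
     hnorm (dsum H r) (mx_mul (map_mx pull F) f) <= M * hnorm (dsum H r) f.
Proof.
move=> M0 FM; apply: mult_defect_psd => //.
have pG := psd_mult_defect M0 FM.
pose s (p : 'I_r * unit_ball R d) := (p.1, tau_ball hd p.2).
have := psd_mul_wker snd balance_free (psd_pull s pG); congr psd.
apply/funext => p; apply/funext => q.
rewrite /= tau_kernel_pull -mulrA -DA_factor; congr (_ * _).
rewrite /mult_defect /=; congr (_ - _); apply: eq_bigr => l _.
by rewrite !mxE.
Qed.

Lemma pullback_mult phi : Mult G phi -> Mult H (pull phi).
Proof.
move=> mphi; have [M M0 phiM] := mult_bounded mphi.
pose F : 'M[unit_disc R -> R[i]]_1 := const_mx phi.
have hF f : rk_set (dsum G 1) f -> rk_set (dsum G 1) (mx_mul F f) /\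
     hnorm (dsum G 1) (mx_mul F f) <= M * hnorm (dsum G 1) f.
  move=> hf.
  have nE g : rk_set (dsum G 1) g -> hnorm (dsum G 1) g = hnorm G (component g ord0).
    move=> hg; rewrite [LHS](@dsum_hnorm _ _ _ G 1 g) // big_ord1 sqrtr_sqr.
    by rewrite ger0_norm // hnorm_ge0.
  have FE i : component (mx_mul F f) i = phi \* component f ord0.
    by apply/funext => x; rewrite /component /mx_mul big_ord1 mxE.
  have hFf : rk_set (dsum G 1) (mx_mul F f).
    by move=> i; rewrite FE; apply: mphi; exact: hf.
  by split => //; rewrite !nE // FE; apply: phiM; exact: hf.
move=> f hf.
have hf1 : rk_set (dsum H 1) (fun p => f p.2) by move=> i.
have [/(_ ord0) h _] := bound_transfer M0 hF hf1.
move: h; congr rk_set; apply/funext => x.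
by rewrite /component /mx_mul big_ord1 !mxE.
Qed.

(** An infinite norm on the disc is covered by the lower bound, which comes from
    the vectors pulled back from the disc. *)
Lemma pullback_mult_norm r (F : 'M[unit_disc R -> R[i]]_r) :
  (forall i j, Mult G (F i j)) -> mult_norm H (map_mx pull F) = mult_norm G F.
Proof.
move=> multF; apply/eqP; rewrite eq_le; apply/andP; split.
  have := mult_norm_ge0 G F.
  case FM : (mult_norm G F) => [M| |]; last by []; last by move=> _; rewrite leey.
  rewrite lee_fin => M0; apply: mult_norm_le => //; apply: bound_transfer => //.
  by apply: mult_norm_bound => //; rewrite FM.
apply: ge_ereal_sup => _ [f [hf f1] <-].
pose g (i : 'I_r) : unit_ball R d -> R[i] := f i \o tau_ball hd.
have pullN (h : 'I_r -> unit_disc R -> R[i]) : hpow G h ->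
    hpow_norm H (fun i => h i \o tau_ball hd) = hpow_norm G h.
  move=> hh; congr Num.sqrt; apply: eq_bigr => i _.
  by have [_ ->] := pullback_isometry hd (hh i).
have hg : hpow H g by move=> i; have [] := pullback_isometry hd (hf i).
have hFf : hpow G (mx_apply F f) by exact: (mx_mul_mem multF (f := curry_fam f)).
rewrite -(pullN _ hFf).
have -> : (fun i => mx_apply F f i \o tau_ball hd) = mx_apply (map_mx pull F) g.
  apply/funext => i; apply/funext => z; apply: eq_bigr => j _.
  by rewrite mxE.
by apply: mult_norm_ge => //; rewrite pullN.
Qed.

End Transfer.

Theorem proposition7p2 (R : realType) (d : nat) (hd : (0 < d)%N)
    (H2d : rkhs (@DA_kernel R d)) (Hd : rkhs (tau_kernel H2d)) :
  set_fun (Mult Hd) (Mult H2d) (tau_pullback hd) /\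
  mult_unital (@tau_pullback R d hd) /\
  complete_isometry Hd H2d (tau_pullback hd).
Proof.
split; first by move=> phi; exact: pullback_mult.
split=> //; split=> // r F multF.
exact: pullback_mult_norm.
Qed.
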